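(* For every $n \in \mathbb N$, the triple $(\mathcal A_n, \mathfrak F, -i\overline{\mathcal D})$ is a weak spectral triple.
   Context: Definition (weak spectral triple). A weak spectral triple $(\mathbb A, \mathbb H, \mathbb D)$ consists of a Hilbert space $\mathbb H$, a self-adjoint operator $\mathbb D \colon \mathrm{dom}(\mathbb D) \to \mathbb H$, and a unital $*$-algebra $\mathbb A \subseteq B(\mathbb H)$, such that for every $a \in \mathbb A$ the commutator $[\mathbb D, a] = \mathbb D a - a \mathbb D$ is densely defined and extends to a bounded operator on $\mathbb H$. Setting. $X$ is a $C^\infty$ manifold and $\Phi^t \colon X \to X$, $t \in \mathbb R$, is a flow generated by a $C^\infty$ vector field $\vec V$, with derivation $Vf = \vec V \cdot \nabla f$ on $C^\infty(X)$. $\mathcal H \subset C^\infty(X)$ is a complex reproducing kernel Hilbert space (RKHS) with strictly positive-definite kernel $k$ and kernel sections $k_x = k(x,\cdot)$, so $f(x) = \langle k_x, f\rangle_{\mathcal H}$ (inner products conjugate-linear in the first argument). As an unbounded operator on $\mathcal H$, $V$ has domain $\{f \in \mathcal H : Vf \in \mathcal H\}$; $V^*$ is its adjoint. Standing assumption 1. (a) $V \colon \mathcal H \to C(X)$ is continuous for the compact-open topology on $C(X)$. (b) $\mathcal H_\infty \subseteq \mathrm{dom}(V) \cap \mathrm{dom}(V^* )$ is a dense subspace of $\mathcal H$ invariant under $V$ and $V^*$. (c) With $V_1 = V$, $V_2 = V^*$, for every $f \in \mathcal H_\infty$ the series $\sum_{n=0}^\infty \frac{z^n}{n!} \sum_{\epsilon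 \colon [n] \to [2]} \lVert V_{\epsilon(1)} \cdots V_{\epsilon(n)} f \rVert_{\mathcal H}$ has a strictly positive radius of convergence, where $[n]=\{1,\dots,n\}$. Standing assumption 2. $\mathcal H$ is a reproducing kernel Hilbert algebra: $k_x \mapsto k_x \otimes k_x$ extends to a bounded linear map $\mathcal H \to \mathcal H \otimes \mathcal H$. $\mathcal S \subset \mathcal H_\infty$ is a finite-dimensional subspace such that the (pointwise) subalgebra generated by $\mathcal S$ is dense in $\mathcal H$. First amplification. On $\mathcal H_\infty$, $A = (V-V^* )/2$, $S = (V+V^* )/2$. $\mathfrak H = \ell^2(\mathbb N) \otimes \mathcal H$, $\mathfrak H_0 = C_c(\mathbb N) \otimes_{\mathrm{alg}} \mathcal H_\infty$, $e_i$ is the canonical basis of $\ell^2(\mathbb N)$, $e_{i,j}$ the matrix units ($e_{i,j}e_j = e_i$), and $L = \sum_{i\ge 1} (e_{i,i+1} \otimes S + e_{i,i} \otimes A - e_{i+1,i} \otimes S)$ on $\mathfrak H_0$, which is essentially skew-adjoint. $E_n f = \sum_{i=1}^n F_i\, e_i \otimes f$ with $F_i$ the Fibonacci numbers ($F_1=F_2=1$), $E_n\colon \mathcal H \to \mathfrak H$. Fock space. $\mathfrak H^{\vee n}$ is the closed subspace of symmetric tensors in $\mathfrak H^{\otimes n}$ ($\mathfrak H^{\vee 0} = \mathbb C$); $u_1 \vee \cdots \vee u_n = \frac1{n!}\sum_{\sigma \in S_n} u_{\sigma(1)} \otimes \cdots \otimes u_{\sigma(n)}$. $\mathfrak F = F_w(\mathfrak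 H)$ is the Hilbert space completion of $\bigoplus_{n\ge0} (\mathfrak H^{\vee n}, w(n)^2 \langle\cdot,\cdot\rangle_{\mathfrak H^{\vee n}})$, with weights $w(n) = e^{\tau n^p}$, $\tau>0$, $p \in (0,1)$; the symmetric tensor product $\vee$ extends to a bounded bilinear commutative unital multiplication on $\mathfrak F$. $\mathcal D$ is the operator on $\mathfrak F$ with domain the linear span of $1 \in \mathbb C$ and all $v_1 \vee\cdots\vee v_n$, $v_i \in \mathfrak H_0$, given by $\mathcal D 1 = 0$ and $\mathcal D(v_1 \vee \cdots \vee v_n) = \sum_i v_1 \vee \cdots \vee Lv_i \vee \cdots \vee v_n$; it is essentially skew-adjoint with closure $\overline{\mathcal D}$. For $u \in \mathfrak H$, the creation operator $a_u^* \in B(\mathfrak F)$ is $a_u^* \eta = u \vee \eta$, and the annihilation operator $a_u \in B(\mathfrak F)$ is its adjoint. $\mathcal A_n \subset B(\mathfrak F)$ is the $*$-algebra generated by $\mathrm{Id}_{\mathfrak F}$ and $\{a_{E_n f} : f \in \mathcal S\}$. *)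

(* Defs.v *)
From HB Require Import structures.
From mathcomp Require Import all_boot all_order all_algebra.
From mathcomp Require Import perm sesquilinear.
From mathcomp Require Import all_classical all_reals all_analysis.
From mathcomp Require Import complex.

Set Implicit Arguments.
Unset Strict Implicit.
Unset Printing Implicit Defensive.

Import Order.TTheory GRing.Theory Num.Theory.
Import numFieldNormedType.Exports.

Local Open Scope classical_set_scope.
Local Open Scope ring_scope.
Local Open Scope complex_scope.

Section Smooth.
Variables (R : realType) (d : nat).

(* One-variable derivatives along the coordinate axes, so that d = 0 is
   allowed ('rV_0 carries no normed-module structure in the library). *)
Definition along (i : 'I_d) (f : 'rV[R]_d -> R) (y : 'rV[R]_d) : R -> R :=
  fun t => f (y + t *: delta_mx 0 i).

Definition partial (i : 'I_d) (f : 'rV[R]_d -> R) (y : 'rV[R]_d) : R :=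
  derive1 (along i f y) 0.

Fixpoint class_C (k : nat) (U : set 'rV[R]_d) (f : 'rV[R]_d -> R) : Prop :=
  (forall y, U y -> {for y, continuous f}) /\
  if k is k'.+1 then
    forall i, (forall y, U y -> derivable (along i f y) 0 1) /\
              class_C k' U (partial i f)
  else True.

(* Only meant for open U. *)
Definition smooth_on (U : set 'rV[R]_d) (f : 'rV[R]_d -> R) : Prop :=
  forall k, class_C k U f.

(* The values of cmap outside cdom, and of cinv outside the image of cdom, are
   irrelevant. *)
Record chart (X : Type) := Chart {
  cdom : set X;
  cmap : X -> 'rV[R]_d;
  cinv : 'rV[R]_d -> X }.

Definition cimg (X : Type) (c : chart X) : set 'rV[R]_d := cmap c @` cdom c.

Definition is_chart (X : topologicalType) (c : chart X) : Prop :=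
  [/\ open (cdom c),
      open (cimg c),
      forall x, cdom c x -> cinv c (cmap c x) = x,
      forall x, cdom c x -> {for x, continuous (cmap c)} &
      forall y, cimg c y -> {for y, continuous (cinv c)}].

Definition transition (X : Type) (c c' : chart X) (j : 'I_d) : 'rV[R]_d -> R :=
  fun y => cmap c' (cinv c y) 0 j.

Record manifold := Manifold {
  mspace :> topologicalType;
  manifold_hausdorff : hausdorff_space mspace;
  manifold_second_countable : @second_countable mspace;
  atlas : set (chart mspace);
  atlas_chart : forall c, atlas c -> is_chart c;
  chart_at : mspace -> chart mspace;
  atlas_chart_at : forall x, atlas (chart_at x);
  mem_chart_at : forall x, cdom (chart_at x) x;
  smooth_transition : forall c c', atlas c -> atlas c' ->
    forall j, smooth_on (cmap c @` (cdom c `&` cdom c')) (transition c c' j) }.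

Variable X : manifold.

Definition smooth (f : X -> R) : Prop :=
  forall c, atlas c -> smooth_on (cimg c) (f \o cinv c).

Definition csmooth (f : X -> R[i]) : Prop :=
  smooth (fun x => complex.Re (f x)) /\ smooth (fun x => complex.Im (f x)).

(* A C^oo vector field, by its components in each chart of the atlas. *)
Record vector_field := VectorField {
  vcomp : chart X -> X -> 'rV[R]_d;
  smooth_vcomp : forall c, atlas c -> forall i,
    smooth_on (cimg c) (fun y => vcomp c (cinv c y) 0 i);
  vcomp_transition : forall c c' x, atlas c -> atlas c' ->
    cdom c x -> cdom c' x -> forall j,
    vcomp c' x 0 j =
      \sum_i vcomp c x 0 i * partial i (transition c c' j) (cmap c x) }.

Variable V : vector_field.

Definition deriv_along (f : X -> R) (x : X) : R :=
  let c := chart_at x in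
  \sum_i vcomp V c x 0 i * partial i (f \o cinv c) (cmap c x).

Definition cderiv_along (f : X -> R[i]) (x : X) : R[i] :=
  deriv_along (fun z => complex.Re (f z)) x
  +i* deriv_along (fun z => complex.Im (f z)) x.

Definition generates_flow (Phi : R -> X -> X) : Prop :=
  [/\ forall x, Phi 0 x = x,
      forall s t x, Phi (s + t) x = Phi s (Phi t x),
      forall x, continuous (Phi^~ x) &
      forall x t c, atlas c -> cdom c (Phi t x) -> forall i,
        is_derive t 1 (fun s : R => cmap c (Phi s x) 0 i)
          (vcomp V c (Phi t x) 0 i)].

End Smooth.
Arguments manifold : clear implicits.

Record hilbert (R : realType) := Hilbert {
  hspace :> completeNormedModType R[i];
  hdot : {dot hspace for Num.conj};
  hdot_norm : forall x : hspace, hdot x x = `|x| ^+ 2 }.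

(* hdot is linear on the left, <x, y> is linear on the right. *)
Definition ip (R : realType) (H : hilbert R) (x y : H) : R[i] :=
  hdot H y x.
Notation "⟪ x , y ⟫" := (ip x y) (at level 0, format "⟪ x ,  y ⟫") : ring_scope.

Definition rnorm (R : realType) (H : hilbert R) (x : H) : R :=
  complex.Re `|x|.

Definition is_subspace (K : numDomainType) (E : lmodType K) (A : set E) : Prop :=
  A 0 /\ forall (a : K) x y, A x -> A y -> A (a *: x + y).

Definition lspan (K : numDomainType) (E : lmodType K) (A : set E) : set E :=
  smallest (@is_subspace K E) A.

Definition bounded_op (R : realType) (H1 H2 : hilbert R) (T : H1 -> H2) : Prop :=
  linear T /\ exists M : R[i], forall x, `|T x| <= M * `|x|.

Section Operators.
Variables (R : realType) (H : hilbert R).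

(* An unbounded operator is represented by its graph. *)
Definition is_operator (G : set (H * H)) : Prop :=
  is_subspace G /\ forall x y z, G (x, y) -> G (x, z) -> y = z.

Definition gdom (G : set (H * H)) : set H := fst @` G.

(* The value at x of the operator of graph G (0 outside its domain). *)
Definition gapp (G : set (H * H)) (x : H) : H := xget 0 [set y | G (x, y)].

Definition gadjoint (G : set (H * H)) : set (H * H) :=
  [set yz | forall xx', G xx' -> ⟪xx'.2, yz.1⟫ = ⟪xx'.1, yz.2⟫].

Definition gscale (c : R[i]) (G : set (H * H)) : set (H * H) :=
  [set xy | exists2 y, G (xy.1, y) & xy.2 = c *: y].

Definition self_adjoint (D : set (H * H)) : Prop :=
  [/\ is_operator D, dense (gdom D) & gadjoint D = D].

(* D a - a D on its natural domain, that is x in dom D with a x in dom D. *)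
Definition gcommutator (D : set (H * H)) (a : H -> H) : set (H * H) :=
  [set xz | exists y1 y2,
    [/\ D (xz.1, y1), D (a xz.1, y2) & xz.2 = y2 - a y1]].

(* Every bounded operator has an adjoint, so the default value is never used on
   B(H). *)
Definition adjoint_op (T : H -> H) : H -> H :=
  xget (fun=> 0)
    [set T' : H -> H | bounded_op T' /\ forall x y, ⟪T' x, y⟫ = ⟪x, T y⟫].

Definition unital_star_subalgebra (A : set (H -> H)) : Prop :=
  [/\ forall a, A a -> bounded_op a,
      A id,
      forall (c : R[i]) a b, A a -> A b -> A (fun x => c *: a x + b x),
      forall a b, A a -> A b -> A (a \o b) &
      forall a, A a -> A (adjoint_op a)].

Definition star_algebra_gen (G : set (H -> H)) : set (H -> H) :=
  smallest unital_star_subalgebra (id |` G).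

Definition weak_spectral_triple (A : set (H -> H)) (D : set (H * H)) : Prop :=
  [/\ self_adjoint D,
      unital_star_subalgebra A &
      forall a, A a ->
        dense (gdom (gcommutator D a)) /\
        exists2 T : H -> H, bounded_op T &
          forall x z, gcommutator D a (x, z) -> T x = z].

End Operators.

(* A Hilbert space completion (here: tensor products, l^2, Fock spaces) is given
   by the data that determines it up to a unique unitary isomorphism: a Hilbert
   space with a map from the algebraic object that has the prescribed inner
   products and a total range. *)

Record tensor_product (R : realType) (H1 H2 : hilbert R) := TensorProduct {
  tp_space :> hilbert R;
  tens : H1 -> H2 -> tp_space;
  tens_linearl : forall y, linear (tens^~ y);
  tens_linearr : forall x, linear (tens x);
  tens_ip : forall x x' y y',
    ⟪tens x y, tens x' y'⟫ = ⟪x, x'⟫ * ⟪y, y'⟫;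
  tens_total : dense (lspan [set z | exists x y, z = tens x y]) }.

Record tensor_power (R : realType) (H : hilbert R) (n : nat) := TensorPower {
  pow_space :> hilbert R;
  tensn : ('I_n -> H) -> pow_space;
  tensn_multilinear : forall (v : 'I_n -> H) i,
    linear (fun x => tensn (fun j => if j == i then x else v j));
  tensn_ip : forall u v, ⟪tensn u, tensn v⟫ = \prod_i ⟪u i, v i⟫;
  tensn_total : dense (lspan (range tensn)) }.

(* The closed subspace of symmetric tensors. The unitary U_s permuting the
   factors, U_s (tensn v) = tensn (v \o s), fixes x for all s if and only if
   all these inner products agree, since decomposable tensors are total. *)
Definition symmetric_tensors (R : realType) (H : hilbert R) (n : nat)
    (T : tensor_power H n) : set T :=
  [set x | forall (s : 'S_n) (v : 'I_n -> H),
    ⟪tensn T (fun i => v (s i)), x⟫ = ⟪tensn T v, x⟫].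

Arguments symmetric_tensors {R H n} T.

Definition vee_tens (R : realType) (H : hilbert R) (n : nat)
    (T : tensor_power H n) (v : 'I_n -> H) : T :=
  (n`!%:R)^-1 *: \sum_(s : 'S_n) tensn T (fun i => v (s i)).

(* l^2(N) with its canonical basis; l2_basis i is the vector e_(i+1). *)
Record ell2 (R : realType) := Ell2 {
  l2_space :> hilbert R;
  l2_basis : nat -> l2_space;
  l2_orthonormal : forall i j, ⟪l2_basis i, l2_basis j⟫ = (i == j)%:R;
  l2_total : dense (lspan (range l2_basis)) }.

(* fock_in n is only relevant on symmetric tensors. *)
Record fock_space (R : realType) (H : hilbert R)
    (T : forall n, tensor_power H n) (w : nat -> R) := FockSpace {
  fk_space :> hilbert R;
  fock_in : forall n, T n -> fk_space;
  fock_in_linear : forall n, linear (@fock_in n);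
  fock_in_ip : forall n (x y : T n),
    symmetric_tensors (T n) x -> symmetric_tensors (T n) y ->
    ⟪fock_in x, fock_in y⟫ = (w n ^+ 2)%:C * ⟪x, y⟫;
  fock_in_orthogonal : forall m n (x : T m) (y : T n), m <> n ->
    symmetric_tensors (T m) x -> symmetric_tensors (T n) y ->
    ⟪fock_in x, fock_in y⟫ = 0;
  fock_in_total : dense (lspan
    [set z | exists n, exists2 x : T n, symmetric_tensors (T n) x & z = fock_in x]) }.

Section Fock.
Variables (R : realType) (H : hilbert R) (T : forall n, tensor_power H n).
Variables (w : nat -> R) (F : fock_space T w).

(* v_1 \/ ... \/ v_n for s = [:: v_1; ...; v_n]; the empty product is the unit
   1 of C = T 0. *)
Definition symprod (s : seq H) : F :=
  fock_in F (vee_tens (T (size s)) (fun i => s`_i)).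

Definition is_fock_mul (m : F -> F -> F) : Prop :=
  [/\ forall y, linear (m^~ y),
      forall x, linear (m x),
      exists M : R[i], forall x y, `|m x y| <= M * `|x| * `|y| &
      forall s s', m (symprod s) (symprod s') = symprod (s ++ s')].

(* The bounded bilinear extension of \/, unique since the symprod s are total. *)
Definition fock_mul : F -> F -> F := xget (fun _ _ => 0) is_fock_mul.

Definition creation (u : H) : F -> F := fock_mul (symprod [:: u]).

Definition annihilation (u : H) : F -> F := adjoint_op (creation u).

(* The derivation of the symmetric products of vectors of dom L that extends
   the operator L. The graph of a linear extension is the span of the graph on
   generators; s = [::] contributes the pair (1, 0). *)
Definition derivation_graph (L : set (H * H)) : set (F * F) :=
  lspan [set xy | exists2 s : seq H, (forall v, v \in s -> gdom L v) &
    xy = (symprod s,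
          \sum_(i < size s) symprod (set_nth 0 s i (gapp L s`_i)))].

End Fock.
Arguments annihilation {R H T w} F u.
Arguments derivation_graph {R H T w} F L.

(* rk_ev is the inclusion of the space in C^oo(X), rk_sec x is the section k_x. *)
Record rkhs (R : realType) (d : nat) (X : manifold R d) := Rkhs {
  rk_space :> hilbert R;
  rk_ev : rk_space -> X -> R[i];
  rk_ev_linear : forall (a : R[i]) f g x,
    rk_ev (a *: f + g) x = a * rk_ev f x + rk_ev g x;
  rk_ev_inj : injective rk_ev;
  rk_ev_smooth : forall f, csmooth (rk_ev f);
  rk_sec : X -> rk_space;
  rk_reproducing : forall f x, rk_ev f x = ⟪rk_sec x, f⟫ }.

Definition rk_kernel (R : realType) (d : nat) (X : manifold R d) (H : rkhs X)
    (x y : X) : R[i] := rk_ev (rk_sec H x) y.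

Definition strictly_positive_definite (R : realType) (X : Type)
    (k : X -> X -> R[i]) : Prop :=
  forall n (x : 'I_n -> X) (c : 'I_n -> R[i]),
    injective x -> (exists i, c i != 0) ->
    0 < \sum_i \sum_j Num.conj (c i) * c j * k (x i) (x j).

(* The pointwise (non-unital) subalgebra of functions generated by B. *)
Definition is_subalgebra (R : realType) (X : Type) (A : set (X -> R[i])) : Prop :=
  [/\ A (fun=> 0),
      forall (a : R[i]) f g, A f -> A g -> A (fun x => a * f x + g x) &
      forall f g, A f -> A g -> A (fun x => f x * g x)].

Definition subalgebra_gen (R : realType) (X : Type) (B : set (X -> R[i])) :
  set (X -> R[i]) := smallest (@is_subalgebra R X) B.

Definition finite_dimensional_subspace (R : realType) (H : hilbert R)
    (A : set H) : Prop :=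
  exists b : seq H, A = lspan [set` b].

Definition radius_of_convergence (R : realType) (a : nat -> R) : \bar R :=
  ereal_sup [set r%:E | r in
    [set r : R | 0 <= r /\ cvgn (series (fun n => `|a n| * r ^+ n))]].

Section Koopman.
Variables (R : realType) (d : nat) (X : manifold R d) (V : vector_field X).
Variables (H : rkhs X).

Definition gen_graph : set (H * H) :=
  [set fg | cderiv_along V (rk_ev fg.1) = rk_ev fg.2].

Definition gen : H -> H := gapp gen_graph.
Definition gen_adj : H -> H := gapp (gadjoint gen_graph).

Definition gen_word (eps : seq bool) (f : H) : H :=
  foldr (fun (b : bool) g => if b then gen_adj g else gen g) f eps.

Definition assumption1 (Hinf : set H) : Prop :=
  [/\ continuous (fun f : H =>
        (cderiv_along V (rk_ev f) : {compact-open, X -> R[i]^o})),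
      [/\ is_subspace Hinf, dense Hinf,
          Hinf `<=` gdom gen_graph `&` gdom (gadjoint gen_graph),
          forall f, Hinf f -> Hinf (gen f) &
          forall f, Hinf f -> Hinf (gen_adj f)] &
      forall f, Hinf f ->
        (0 < radius_of_convergence (fun n =>
           (\sum_(eps : n.-tuple bool) rnorm (gen_word eps f)) / n`!%:R)%R)%E].

Definition assumption2 (HH : tensor_product H H) (Hinf S : set H) : Prop :=
  [/\ exists2 Delta : H -> HH, bounded_op Delta &
        forall x, Delta (rk_sec H x) = tens HH (rk_sec H x) (rk_sec H x),
      finite_dimensional_subspace S,
      S `<=` Hinf &
      dense [set f : H | subalgebra_gen (@rk_ev _ _ _ H @` S) (rk_ev f)]].

Definition skew_part (f : H) : H := 2^-1 *: (gen f - gen_adj f).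
Definition sym_part (f : H) : H := 2^-1 *: (gen f + gen_adj f).

Variables (l2 : ell2 R) (K : tensor_product l2 H).

Local Notation e := (l2_basis l2).

Definition matrix_unit (i j : nat) (x : l2) : l2 := ⟪e j, x⟫ *: e i.

(* The value at e_j (x) f of the sum defining L; its terms of index i > j are
   zero. *)
Definition ampl_basis (j : nat) (f : H) : K :=
  \sum_(i < j.+1)
    (tens K (matrix_unit i i.+1 (e j)) (sym_part f)
     + tens K (matrix_unit i i (e j)) (skew_part f)
     - tens K (matrix_unit i.+1 i (e j)) (sym_part f)).

(* The domain, the span of the e_j (x) f, is C_c(N) (x)_alg Hinf. *)
Definition ampl_graph (Hinf : set H) : set (K * K) :=
  lspan [set xy | exists j, exists2 f, Hinf f &
    xy = (tens K (e j) f, ampl_basis j f)].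

Fixpoint fib (n : nat) : nat :=
  match n with
  | 0 => 0
  | 1 => 1
  | (n''.+1 as n').+1 => (fib n' + fib n'')%N
  end.

Definition fib_embed (n : nat) (f : H) : K :=
  \sum_(i < n) (fib i.+1)%:R *: tens K (e i) f.

Variables (T : forall n, tensor_power K n) (w : nat -> R) (F : fock_space T w).

Definition fock_algebra (S : set H) (n : nat) : set (F -> F) :=
  star_algebra_gen [set annihilation F (fib_embed n f) | f in S].

Definition fock_generator (Hinf : set H) : set (F * F) :=
  derivation_graph F (ampl_graph Hinf).

End Koopman.
Arguments fock_algebra {R d X H l2 K T w} F S n.
Arguments fock_generator {R d X} V {H l2 K T w} F Hinf.

Definition subexp_weight (R : realType) (tau p : R) (n : nat) : R :=
  expR (tau * (n%:R `^ p)).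

(* Main.v *)
(** The derivation graph is skew-symmetric, so it is enough to exhibit a total set
of analytic vectors and to run a form of Nelson's argument. A jet of a closed
skew-symmetric graph [G] is a sequence [x] with [(x n, x n.+1)] in [G] and
[|x n| <= C rho^n n!]. The exponential series [x' n = \sum_k s^k/k! x (n + k)]
converges for small [s] and is again a jet, with [|x' n| <= |x n|] by skew
symmetry. If [y] is orthogonal to the range of [G - 1], the pairing of [y] with
[x 0] gets multiplied by [e^s >= 1 + s] at each step while it stays bounded, so
it vanishes; hence [G + 1] and [G - 1] have dense range and [-i G] is
self-adjoint.

Assumption 1(c) gives jets of [L] at the vectors [e_j (x) f], and the Leibniz rule
turns jets of the factors into jets of their symmetric products; both kinds of
vectors are total. Finally [[D, a_u^*] = a_(L u)^*] is bounded for [u] in the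
domain of [L], and the bounded operators that preserve the domain of a
skew-adjoint operator and have a bounded commutator with it form a unital
*-algebra. *)

Require Import Defs.
From HB Require Import structures.
From mathcomp Require Import all_boot all_order all_algebra.
From mathcomp Require Import perm sesquilinear.
From mathcomp Require Import all_classical all_reals all_analysis.
From mathcomp Require Import complex.
From mathcomp Require Import ring lra.

Set Implicit Arguments.
Unset Strict Implicit.
Unset Printing Implicit Defensive.

Import Order.TTheory GRing.Theory Num.Theory.
Import numFieldNormedType.Exports.
Local Open Scope classical_set_scope.
Local Open Scope ring_scope.
Local Open Scope complex_scope.

(** * Hilbert space geometry in terms of real norms *)

Local Notation normc := Normc.normc.

Section RealNorm.
Variables (R : realType).
Implicit Types (z : R[i]) (H : hilbert R).

Lemma Re_add z z' : complex.Re (z + z') = complex.Re z + complex.Re z'.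
Proof. by case: z; case: z'. Qed.

Lemma Re_opp z : complex.Re (- z) = - complex.Re z.
Proof. by case: z. Qed.

Lemma complexRe_conj z : complex.Re (Num.conj z) = complex.Re z.
Proof. by case: z. Qed.

Lemma Re_realM (a : R) z : complex.Re (a%:C * z) = a * complex.Re z.
Proof. by case: z => x y /=; rewrite mul0r subr0. Qed.

Lemma normcE z : `|z| = (normc z)%:C.
Proof. by []. Qed.

Lemma normc_ge0 z : 0 <= normc z.
Proof. by rewrite -lecR -normcE normr_ge0. Qed.

Lemma normc_real (a : R) : normc a%:C = `|a|.
Proof. by rewrite /= expr0n addr0 sqrtr_sqr. Qed.

Lemma Re_le_normc z : complex.Re z <= normc z.
Proof. by apply: le_trans (ler_norm _) _; rewrite -lecR -normcE normc_ge_Re. Qed.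

Lemma normc_eq0 z : (normc z == 0) = (z == 0).
Proof.
apply/eqP/eqP => [/Normc.eq0_normc//|->]; exact: Normc.normc0.
Qed.

Lemma normc_le_eps z : (forall e : R, 0 < e -> normc z <= e) -> z = 0.
Proof.
move=> h; apply/eqP; rewrite -normc_eq0 eq_le normc_ge0 andbT.
by apply/ler_addgt0Pl => e e0; rewrite addr0 h.
Qed.

Variable H : hilbert R.
Implicit Types x y : H.

Lemma rnormE x : `|x| = (rnorm x)%:C.
Proof.
have := normr_ge0 x; rewrite /rnorm; case: (`|x|) => a b; rewrite lecE /=.
by move=> /andP[/eqP -> _].
Qed.

Lemma rnorm_ge0 x : 0 <= rnorm x.
Proof. by rewrite -lecR -rnormE normr_ge0. Qed.

Lemma rnorm0 : rnorm (0 : H) = 0.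
Proof. by rewrite /rnorm normr0. Qed.

Lemma rnorm_eq0 x : rnorm x = 0 -> x = 0.
Proof. by move=> h; apply/eqP; rewrite -normr_eq0 rnormE h. Qed.

Lemma rnorm_gt0 x : x <> 0 -> 0 < rnorm x.
Proof.
by move=> h; rewrite lt_neqAle rnorm_ge0 andbT eq_sym; apply/eqP => /rnorm_eq0.
Qed.

Lemma rnormN x : rnorm (- x) = rnorm x.
Proof. by rewrite /rnorm normrN. Qed.

Lemma rnormB x y : rnorm (x - y) = rnorm (y - x).
Proof. by rewrite -rnormN opprB. Qed.

Lemma rnormZ z x : rnorm (z *: x) = normc z * rnorm x.
Proof. by apply: (@complexI R); rewrite -rnormE normrZ rnormE rmorphM. Qed.

Lemma ler_rnormD x y : rnorm (x + y) <= rnorm x + rnorm y.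
Proof. by rewrite -lecR (rmorphD (real_complex R)) /= -!rnormE ler_normD. Qed.

Lemma ler_rnormB x y : rnorm (x - y) <= rnorm x + rnorm y.
Proof. by rewrite -(rnormN y); exact: ler_rnormD. Qed.

Lemma ler_rnorm_distD (t x y : H) : rnorm (x - y) <= rnorm (x - t) + rnorm (t - y).
Proof. by apply: le_trans (ler_rnormD _ _); rewrite addrA subrK. Qed.

Lemma ler_rnorm_sum I (r : seq I) (P : pred I) (f : I -> H) :
  rnorm (\sum_(i <- r | P i) f i) <= \sum_(i <- r | P i) rnorm (f i).
Proof.
elim/big_rec2: _ => [|i y x _ h]; first by rewrite rnorm0.
by apply: le_trans (ler_rnormD _ _) _; rewrite lerD2l.
Qed.

Lemma ipDl x x' y : ⟪x + x', y⟫ = ⟪x, y⟫ + ⟪x', y⟫.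
Proof. by rewrite /ip linearDr. Qed.

Lemma ipDr x y y' : ⟪x, y + y'⟫ = ⟪x, y⟫ + ⟪x, y'⟫.
Proof. by rewrite /ip linearDl. Qed.

Lemma ipZl z x y : ⟪z *: x, y⟫ = Num.conj z * ⟪x, y⟫.
Proof. by rewrite /ip linearZr_LR. Qed.

Lemma ipZr z x y : ⟪x, z *: y⟫ = z * ⟪x, y⟫.
Proof. by rewrite /ip linearZl_LR. Qed.

Lemma ipC x y : ⟪x, y⟫ = Num.conj ⟪y, x⟫.
Proof. by rewrite /ip (hermC (hdot H)) expr0 mul1r. Qed.

Lemma ip0r x : ⟪x, 0⟫ = 0.
Proof. by rewrite -(scale0r (0 : H)) ipZr mul0r. Qed.

Lemma ip0l x : ⟪0, x⟫ = 0.
Proof. by rewrite ipC ip0r rmorph0. Qed.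

Lemma ipNr x y : ⟪x, - y⟫ = - ⟪x, y⟫.
Proof. by rewrite -scaleN1r ipZr mulN1r. Qed.

Lemma ipNl x y : ⟪- x, y⟫ = - ⟪x, y⟫.
Proof. by rewrite ipC ipNr rmorphN /= -ipC. Qed.

Lemma ipBr x y y' : ⟪x, y - y'⟫ = ⟪x, y⟫ - ⟪x, y'⟫.
Proof. by rewrite ipDr ipNr. Qed.

Lemma ipBl x x' y : ⟪x - x', y⟫ = ⟪x, y⟫ - ⟪x', y⟫.
Proof. by rewrite ipDl ipNl. Qed.

Lemma ip_sumr I (r : seq I) (P : pred I) x (f : I -> H) :
  ⟪x, \sum_(i <- r | P i) f i⟫ = \sum_(i <- r | P i) ⟪x, f i⟫.
Proof. by apply: (big_morph (ip x)); [exact: ipDr|exact: ip0r]. Qed.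

Lemma ip_suml I (r : seq I) (P : pred I) (f : I -> H) y :
  ⟪\sum_(i <- r | P i) f i, y⟫ = \sum_(i <- r | P i) ⟪f i, y⟫.
Proof. apply: (big_morph (fun x => ⟪x, y⟫)) => [? ?|]; [exact: ipDl|exact: ip0l]. Qed.

Lemma ipxx x : ⟪x, x⟫ = (rnorm x ^+ 2)%:C.
Proof. by rewrite /ip hdot_norm rnormE rmorphXn. Qed.

Lemma ipxx_eq0 x : ⟪x, x⟫ = 0 -> x = 0.
Proof.
by rewrite ipxx => -[/eqP]; rewrite sqrf_eq0 => /eqP /rnorm_eq0.
Qed.

Lemma rnorm_sqr x : rnorm x ^+ 2 = complex.Re ⟪x, x⟫.
Proof. by rewrite ipxx. Qed.

Lemma rnormD_sqr x y :
  rnorm (x + y) ^+ 2 = rnorm x ^+ 2 + rnorm y ^+ 2 + 2 * complex.Re ⟪x, y⟫.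
Proof.
rewrite !rnorm_sqr ipDl !ipDr !Re_add (ipC y x) complexRe_conj; ring.
Qed.

Lemma rnormB_sqr x y :
  rnorm (x - y) ^+ 2 = rnorm x ^+ 2 + rnorm y ^+ 2 - 2 * complex.Re ⟪x, y⟫.
Proof. by rewrite rnormD_sqr rnormN ipNr Re_opp mulrN. Qed.

(** The squared norm of [(rnorm y)%:C *: x - (rnorm x)%:C *: y] is nonnegative, and its expansion is
    divisible by the product of the two norms. *)
Lemma cauchy_schwarz_Re x y : complex.Re ⟪x, y⟫ <= rnorm x * rnorm y.
Proof.
have [->|x0] := pselect (x = 0); first by rewrite ip0l rnorm0 mul0r.
have [->|y0] := pselect (y = 0); first by rewrite ip0r rnorm0 mulr0.
have px := rnorm_gt0 x0; have py := rnorm_gt0 y0.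
have := sqr_ge0 (rnorm ((rnorm y)%:C *: x - (rnorm x)%:C *: y)).
rewrite rnormB_sqr !rnormZ !normc_real !ger0_norm ?rnorm_ge0//.
rewrite ipZl ipZr mulrA (_ : Num.conj (rnorm y)%:C = (rnorm y)%:C).
  rewrite -rmorphM Re_realM => h.
  rewrite -(ler_pM2l (mulr_gt0 px py)); nra.
by rewrite /Num.conj /= oppr0.
Qed.

(** Scaling [x] by [a] = ⟪x, y⟫ makes the inner product the real number |a|^2, and one factor |a|
    cancels. *)
Lemma cauchy_schwarz x y : normc ⟪x, y⟫ <= rnorm x * rnorm y.
Proof.
have [h|h] := eqVneq ⟪x, y⟫ 0.
  by rewrite h Normc.normc0 mulr_ge0 ?rnorm_ge0.
set a := ⟪x, y⟫ in h *; set n := normc a.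
have n0 : 0 < n by rewrite lt_neqAle normc_ge0 andbT eq_sym normc_eq0.
have := cauchy_schwarz_Re (a *: x) y; rewrite ipZl -/a rnormZ -/n.
have -> : Num.conj a * a = (n ^+ 2)%:C.
  by rewrite mulrC -normCK normcE rmorphXn.
by rewrite /= expr2 -mulrA ler_pM2l.
Qed.

End RealNorm.

(** * Closures, density and geometric convergence with real radii *)

Section Limits.
Variables (R : realType) (H : hilbert R).
Implicit Types (x y : H) (A : set H).

(** Balls of the normed module have radii in [R[i]]. A positive radius is real, so closures and
    limits can be tested with real radii. *)
Lemma complex_gt0P (e : R[i]) : 0 < e -> exists2 r : R, 0 < r & e = r%:C.
Proof.
case: e => a b; rewrite ltcE /= => /andP[/eqP -> a0]; by exists a.
Qed.

Lemma ballE x y (e : R) : ball x e%:C y <-> rnorm (x - y) < e.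
Proof. by rewrite -ball_normE /ball_ /= rnormE ltcR. Qed.

Lemma real_complex_gt0 (e : R) : 0 < e -> 0 < e%:C.
Proof. by rewrite ltcR. Qed.

Lemma closureP A x :
  closure A x <-> forall e : R, 0 < e -> exists2 y, A y & rnorm (x - y) < e.
Proof.
split=> [h e /real_complex_gt0 e0|h B].
  by have [y [Ay /ballE]] := h _ (nbhsx_ballx x _ e0); exists y.
move=> /nbhs_ballP[_/posnumP[e] eB].
have [r r0 er] := complex_gt0P (gt0 e).
have [y Ay xy] := h r r0; exists y; split => //.
by apply: eB; rewrite er; apply/ballE.
Qed.

Lemma closure_graphP (G : set (H * H)) p :
  closure G p <-> forall e : R, 0 < e ->
    exists2 q, G q & rnorm (p.1 - q.1) < e /\ rnorm (p.2 - q.2) < e.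
Proof.
split=> [h e /real_complex_gt0 e0|h B].
  have [q [Gq [/ballE q1 /ballE q2]]] := h _ (nbhsx_ballx p _ e0); by exists q.
move=> /nbhs_ballP[_/posnumP[e] eB].
have [r r0 er] := complex_gt0P (gt0 e).
have [q Gq [xq yq]] := h r r0; exists q; split => //.
by apply: eB; rewrite er; split; apply/ballE.
Qed.

Lemma denseP A : dense A <-> forall x, closure A x.
Proof.
split=> [h x|h O [x Ox] oO].
  apply/closureP => e /real_complex_gt0 e0.
  have [|y [/interior_subset/ballE xy Ay]] := h _ _ (open_interior (ball x e%:C)).
    exists x; exact: nbhsx_ballx.
  by exists y.
have [y [Ay Oy]] := h x O (open_nbhs_nbhs (conj oO Ox)); by exists y.
Qed.

Lemma half_pow_small (C e : R) : 0 < e -> exists N, C / 2 ^+ N < e.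
Proof.
move=> e0; exists (Num.Def.archi_bound (C / e)).
rewrite ltr_pdivrMr ?exprn_gt0// mulrC -ltr_pdivrMr//.
exact: upper_nthrootP.
Qed.

(** The explicit rate serves both the minimising sequences of orthogonal projections and the
    exponential series of jets. *)
Lemma geometric_limit (u : nat -> H) (C : R) :
  (forall n, rnorm (u n.+1 - u n) <= C / 2 ^+ n) ->
  exists l, forall n, rnorm (l - u n) <= 2 * C / 2 ^+ n.
Proof.
move=> hu.
have pow2_gt0 n : 0 < 2 ^+ n :> R by rewrite exprn_gt0.
(* The subtracted term is what makes the induction on [k] close. *)
have step n k : rnorm (u (n + k)%N - u n) <= 2 * C / 2 ^+ n - 2 * C / 2 ^+ (n + k).
  elim: k => [|k IH]; first by rewrite addn0 !subrr rnorm0.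
  have := ler_rnorm_distD (u (n + k)%N) (u (n + k.+1)%N) (u n).
  have := hu (n + k)%N; rewrite addnS exprS invfM => h1 h2; lra.
have C0 : 0 <= C.
  by have := le_trans (rnorm_ge0 _) (hu 0%N); rewrite expr0 divr1.
have bound n k : rnorm (u (n + k)%N - u n) <= 2 * C / 2 ^+ n.
  apply: le_trans (step n k) _; rewrite gerBl divr_ge0 ?mulr_ge0//.
have small (e : R) : 0 < e -> exists N, 2 * C / 2 ^+ N < e by exact: half_pow_small.
have : cvg (u @ \oo).
  apply/cauchy_cvgP/cauchy_exP => _/posnumP[e].
  have [r r0 er] := complex_gt0P (gt0 e).
  have [N hN] := small r r0; exists (u N); exists N => //= n /= Nn.
  rewrite er; apply/ballE; rewrite rnormB -(subnKC Nn).
  exact: le_lt_trans (bound _ _) hN.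
move=> /cvg_ballP ul; exists (lim (u @ \oo)) => n.
apply/ler_addgt0Pl => e e0.
have [N _ hN] := ul _ (real_complex_gt0 e0).
have /ballE h := hN (n + N)%N (leq_addl _ _).
apply: le_trans (ler_rnorm_distD (u (n + N)%N) _ _) _.
have hb := bound n N; lra.
Qed.
End Limits.

(** * Subspaces and linear spans *)

Section Subspaces.
Variables (K : numDomainType) (E : lmodType K).
Implicit Types A B : set E.

Lemma subspace0 A : is_subspace A -> A 0.
Proof. by case. Qed.

Lemma subspaceZD A (a : K) x y : is_subspace A -> A x -> A y -> A (a *: x + y).
Proof. by case=> _; exact. Qed.

Lemma subspaceD A x y : is_subspace A -> A x -> A y -> A (x + y).
Proof. by move=> As Ax Ay; rewrite -(scale1r x); exact: subspaceZD. Qed.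

Lemma subspaceZ A (a : K) x : is_subspace A -> A x -> A (a *: x).
Proof.
by move=> As Ax; rewrite -(addr0 (a *: x)); apply: subspaceZD => //; exact: subspace0.
Qed.

Lemma subspaceB A x y : is_subspace A -> A x -> A y -> A (x - y).
Proof.
by move=> As Ax Ay; rewrite addrC -scaleN1r; exact: subspaceZD.
Qed.

Lemma subspace_sum A I (r : seq I) (P : pred I) (f : I -> E) :
  is_subspace A -> (forall i, P i -> A (f i)) -> A (\sum_(i <- r | P i) f i).
Proof.
move=> As Af; elim/big_rec: _ => [|i x Pi Ax]; first exact: subspace0.
by apply: subspaceD => //; exact: Af.
Qed.

Lemma lspan_subspace A : is_subspace (lspan A).
Proof.
split=> [B [[B0 _] _]//|a x y hx hy B [Bs AB]].
by apply: subspaceZD => //; [exact: hx|exact: hy].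
Qed.

Lemma sub_lspan A : A `<=` lspan A.
Proof. by move=> x Ax B [_]; exact. Qed.

Lemma lspan_min A B : is_subspace B -> A `<=` B -> lspan A `<=` B.
Proof. by move=> Bs AB x; apply. Qed.

End Subspaces.

(** * Orthogonal projection, totality and Riesz representation *)

Section HilbertGeometry.
Variables (R : realType) (H : hilbert R).
Implicit Types (x y : H) (A : set H).

Lemma sub_closure A : A `<=` closure A.
Proof. exact: subset_closure. Qed.

Lemma ip_closure_eq0 A y : (forall x, A x -> ⟪x, y⟫ = 0) ->
  forall x, closure A x -> ⟪x, y⟫ = 0.
Proof.
move=> Ay x /closureP xA; apply: normc_le_eps => e e0.
have d0 : 0 < e / (1 + rnorm y) by rewrite divr_gt0// ltr_wpDr// rnorm_ge0.
have [a Aa xa] := xA _ d0.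
rewrite -(subrK a x) ipDl (Ay a Aa) addr0.
apply: le_trans (cauchy_schwarz _ _) _.
have y0 := rnorm_ge0 y.
have : rnorm (x - a) * (1 + rnorm y) <= e by rewrite -ler_pdivlMr ?ltW// ltr_wpDr.
by have := rnorm_ge0 (x - a); nra.
Qed.

Lemma closure_subspace A : is_subspace A -> is_subspace (closure A).
Proof.
move=> As; split=> [|c x y /closureP xA /closureP yA].
  exact: sub_closure (subspace0 As).
apply/closureP => e e0.
have e20 : 0 < e / 2 by rewrite divr_gt0.
have n0 : 0 < 1 + normc c by rewrite ltr_wpDr ?normc_ge0.
have [a Aa xa] := xA _ (divr_gt0 e20 n0).
have [b Ab yb] := yA _ e20.
exists (c *: a + b); first exact: subspaceZD.
have -> : c *: x + y - (c *: a + b) = c *: (x - a) + (y - b).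
  by rewrite scalerBr opprD addrACA.
apply: le_lt_trans (ler_rnormD _ _) _; rewrite rnormZ.
have : rnorm (x - a) * (1 + normc c) < e / 2 by rewrite -ltr_pdivlMr.
have := rnorm_ge0 (x - a); have := normc_ge0 c; nra.
Qed.

(** A sequence minimising the distance from [x] to [A] is Cauchy by the parallelogram law, and the
    first-order condition at its limit is the orthogonality. *)
Lemma orthogonal_projection A x : is_subspace A -> closure A `<=` A ->
  exists2 l, A l & forall a, A a -> ⟪a, x - l⟫ = 0.
Proof.
move=> As Acl; pose D := [set rnorm (x - a) ^+ 2 | a in A].
have D0 : has_inf D.
  split; first by exists (rnorm (x - 0) ^+ 2), 0 => //; exact: subspace0.
  by exists 0 => _ [a _ <-]; rewrite sqr_ge0.
have Dlb a : A a -> inf D <= rnorm (x - a) ^+ 2.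
  by move=> Aa; apply: ge_inf => //; [case: D0|exists a].
have /choice[m hm] n : exists a, A a /\ rnorm (x - a) ^+ 2 < inf D + (2 ^- n) ^+ 2.
  have e0 : 0 < (2 ^- n) ^+ 2 :> R by rewrite exprn_gt0// invr_gt0 exprn_gt0.
  by have [_ [a Aa <-] ha] := inf_adherent e0 D0; exists a.
have mA n : A (m n) by case: (hm n).
have md n : rnorm (x - m n) ^+ 2 < inf D + (2 ^- n) ^+ 2 by case: (hm n).
have pow0 n : 0 < 2 ^- n :> R by rewrite invr_gt0 exprn_gt0.
(* The midpoint of [m n] and [m n.+1] lies in [A], so the parallelogram law bounds the square by 2
   (q^2 + q^2 / 4) with [q] = 2^-n. *)
have step n : rnorm (m n.+1 - m n) <= 2 / 2 ^+ n.
  rewrite -(@ler_pXn2r _ 2) ?nnegrE ?rnorm_ge0 ?divr_ge0 ?exprn_ge0//.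
  have e1 : m n.+1 - m n = (x - m n) - (x - m n.+1).
    by rewrite opprB [RHS]addrC addrA subrK.
  have e2 : (x - m n) + (x - m n.+1) = 2 *: (x - 2^-1 *: (m n + m n.+1)).
    rewrite scalerBr scalerA divff ?pnatr_eq0// scale1r scaler_nat mulr2n.
    by rewrite addrACA opprD.
  have h1 := rnormB_sqr (x - m n) (x - m n.+1).
  have h2 := rnormD_sqr (x - m n) (x - m n.+1).
  have h3 : inf D <= rnorm (x - 2^-1 *: (m n + m n.+1)) ^+ 2.
    by apply: Dlb; apply: subspaceZ => //; exact: subspaceD.
  have := md n.+1; have := md n; rewrite e1 h1; move: h2; rewrite e2 rnormZ.
  have -> : normc (2 : R[i]) = 2 by rewrite -[2](rmorph_nat (real_complex R)) normc_real ger0_norm.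
  have -> : 2 ^- n.+1 = 2 ^- n / 2 :> R by rewrite exprS invfM mulrC.
  by set q := 2 ^- n; nra.
have [l hl] := geometric_limit step.
have Al : A l.
  apply: Acl; apply/closureP => e e0.
  have [N hN] := half_pow_small (2 * 2) e0.
  by exists (m N) => //; apply: le_lt_trans (hl N) hN.
(* Moving [m N] by 2^-N [a] changes the squared distance to first order in 2^-N, while [m N] misses
   the infimum by at most 4^-N. *)
have Re_le0 a : A a -> complex.Re ⟪a, x - l⟫ <= 0.
  move=> Aa; apply/ler_addgt0Pl => e e0; rewrite addr0.
  set na := rnorm a; have na0 : 0 <= na by exact: rnorm_ge0.
  have [N hN] := half_pow_small (1 + na ^+ 2 + 2 * 2 * na) e0.
  apply: le_trans (ltW hN).
  have -> : x - l = (x - m N) - (l - m N) by rewrite opprB addrA subrK.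
  rewrite ipBr Re_add Re_opp.
  have h1 : - complex.Re ⟪a, l - m N⟫ <= na * (2 * 2 / 2 ^+ N).
    rewrite -Re_opp -ipNl; apply: le_trans (cauchy_schwarz_Re _ _) _.
    by rewrite rnormN ler_wpM2l.
  have h2 : inf D <= rnorm (x - m N - (2 ^- N)%:C *: a) ^+ 2.
    rewrite -addrA -opprD; apply: Dlb; apply: subspaceD => //; exact: subspaceZ.
  have := md N; have := pow0 N; move: h2; rewrite (rnormB_sqr (x - m N)) rnormZ normc_real.
  rewrite gtr0_norm// ipZr Re_realM. rewrite (ipC (x - m N) a) complexRe_conj -/na exprMn.
  set q := 2 ^- N in h1 *; set r := complex.Re ⟪a, x - m N⟫; set p := rnorm _.
  move=> h2 q0 h3.
  have : q * (2 * r) <= q * (q * (1 + na ^+ 2)) by lra.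
  by rewrite ler_pM2l// => h4; rewrite -/q; nra.
(* Testing with [z *: a] in place of [a] turns the real part into |z|^2. *)
exists l => // a Aa; set z := ⟪a, x - l⟫.
have := Re_le0 (z *: a) (subspaceZ _ As Aa).
rewrite ipZl -/z mulrC -normCK normcE -rmorphXn /=.
by rewrite exprn_even_le0//= => /eqP/eqP; rewrite normc_eq0 => /eqP.
Qed.

(** The residual of the projection onto the closure of [A] is orthogonal to [A]. *)
Lemma dense_orthoP A : is_subspace A ->
  dense A <-> forall y, (forall x, A x -> ⟪x, y⟫ = 0) -> y = 0.
Proof.
move=> As; split=> [/denseP dA y /ip_closure_eq0 yA|h].
  exact/ipxx_eq0/yA.
apply/denseP => x.
have clcl : closure (closure A) `<=` closure A by exact: closed_closure.
have [l Al hl] := orthogonal_projection x (closure_subspace As) clcl.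
suff -> : x = l by [].
apply/eqP; rewrite -subr_eq0; apply/eqP/h => a Aa; exact/hl/sub_closure.
Qed.

Lemma total_orthoP A :
  dense (lspan A) <-> forall y, (forall x, A x -> ⟪x, y⟫ = 0) -> y = 0.
Proof.
rewrite (dense_orthoP (lspan_subspace A)); split=> h y yA; apply: h => x.
  move: x; apply: lspan_min => //; split=> [|c x x' /= hx hx'].
    exact: ip0l.
  by rewrite ipDl ipZl hx hx' mulr0 addr0.
by move=> Ax; apply: yA; exact: sub_lspan.
Qed.

Lemma eq_ipr y y' : (forall x, ⟪x, y⟫ = ⟪x, y'⟫) -> y = y'.
Proof.
move=> h; apply/eqP; rewrite -subr_eq0; apply/eqP/ipxx_eq0.
by rewrite ipBr h subrr.
Qed.

(** Let [z] be the residual of projecting a vector outside the kernel onto the kernel. Every [x]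
    differs from a multiple of [z] by an element of the kernel, so a multiple of [z] represents
    [phi]. *)
Lemma riesz (phi : H -> R[i]) (M : R) :
  (forall c x y, phi (c *: x + y) = c * phi x + phi y) ->
  (forall x, normc (phi x) <= M * rnorm x) ->
  exists v, forall x, phi x = ⟪v, x⟫.
Proof.
move=> phiL phiM; pose N := [set x | phi x = 0].
have phi0 : phi 0 = 0.
  by have := phiL (-1) 0 0; rewrite scaler0 addr0 mulN1r addNr.
have Ns : is_subspace N.
  by split=> // c x y hx hy; rewrite /N /= phiL hx hy mulr0 addr0.
have Ncl : closure N `<=` N.
  move=> x /closureP xN; apply: normc_le_eps => e e0.
  have d0 : 0 < e / (1 + `|M|) by rewrite divr_gt0// ltr_wpDr.
  have [a Na xa] := xN _ d0.
  rewrite -(subrK a x) -(scale1r (x - a)) phiL Na addr0 mul1r.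
  apply: le_trans (phiM _) _.
  have : rnorm (x - a) * (1 + `|M|) <= e by rewrite -ler_pdivlMr ?ltW// ltr_wpDr.
  by have := rnorm_ge0 (x - a); have := ler_norm M; nra.
have [h|/existsNP[x0 hx0]] := pselect (forall x, phi x = 0).
  by exists 0 => x; rewrite h ip0l.
have [l Nl hl] := orthogonal_projection x0 Ns Ncl.
set z := x0 - l in hl.
have phiz : phi z = phi x0.
  by rewrite /z addrC -scaleN1r phiL Nl mulr0 add0r.
have pz0 : phi z != 0 by rewrite phiz; exact/eqP.
have z0 : ⟪z, z⟫ != 0.
  apply/eqP => /ipxx_eq0 zz; by rewrite zz phi0 eqxx in pz0.
exists (Num.conj (phi z / ⟪z, z⟫) *: z) => x.
have : N (- (phi x / phi z) *: z + x).
  by rewrite /N /= phiL mulNr divfK// addNr.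
move/hl; rewrite ipC => /(congr1 Num.conj); rewrite rmorph0 conjCK ipDr ipZr.
move/eqP; rewrite mulNr addrC subr_eq0 => /eqP e.
by rewrite ipZl conjCK e; field; rewrite z0 pz0.
Qed.

End HilbertGeometry.

(** * Bounded operators and their adjoints *)

Section BoundedOps.
Variables (R : realType) (H1 H2 : hilbert R).

Lemma bounded_opP (T : H1 -> H2) : bounded_op T <->
  linear T /\ exists2 M : R, 0 <= M & forall x, rnorm (T x) <= M * rnorm x.
Proof.
split=> [[TL [M hM]]|[TL [M M0 hM]]]; split => //; last first.
  by exists M%:C => x; rewrite !rnormE -rmorphM lecR.
exists `|complex.Re M| => // x; have := hM x; rewrite !rnormE lecE => /andP[_].
rewrite mulrC Re_realM /= => /le_trans; apply.
by rewrite mulrC ler_wpM2r ?rnorm_ge0// ler_norm.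
Qed.

End BoundedOps.

Section Adjoint.
Variables (R : realType) (H : hilbert R).
Implicit Types (T : H -> H).

Lemma bounded_id : bounded_op (@id H).
Proof. by apply/bounded_opP; split => //; exists 1 => // x; rewrite mul1r. Qed.

Lemma bounded_cst0 : bounded_op (fun _ : H => 0 : H).
Proof.
apply/bounded_opP; split; first by move=> c x y; rewrite scaler0 addr0.
by exists 0 => // x; rewrite rnorm0 mul0r.
Qed.

Lemma bounded_lin (c : R[i]) T T' : bounded_op T -> bounded_op T' ->
  bounded_op (fun x => c *: T x + T' x).
Proof.
move=> /bounded_opP[TL [M M0 hM]] /bounded_opP[TL' [M' M0' hM']].
apply/bounded_opP; split.
  move=> a x y; rewrite TL TL' !scalerDr !scalerA (mulrC c) -!addrA; congr (_ + _).
  by rewrite addrCA.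
exists (normc c * M + M') => [|x]; first by rewrite addr_ge0// mulr_ge0// normc_ge0.
apply: le_trans (ler_rnormD _ _) _; rewrite rnormZ mulrDl lerD//.
by rewrite -mulrA ler_wpM2l ?normc_ge0.
Qed.

Lemma bounded_comp T T' : bounded_op T -> bounded_op T' -> bounded_op (T \o T').
Proof.
move=> /bounded_opP[TL [M M0 hM]] /bounded_opP[TL' [M' M0' hM']].
apply/bounded_opP; split; first by move=> a x y /=; rewrite TL' TL.
exists (M * M') => [|x /=]; first by rewrite mulr_ge0.
by apply: le_trans (hM _) _; rewrite -mulrA ler_wpM2l.
Qed.

(** Riesz representation of the functionals ⟪x, T y⟫ of [y] supplies a candidate [T'] for [xget];
    its bound comes from |T' x|^2 = ⟪x, T (T' x)⟫. *)
Lemma adjoint_opP T : bounded_op T ->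
  bounded_op (adjoint_op T) /\ forall x y, ⟪adjoint_op T x, y⟫ = ⟪x, T y⟫.
Proof.
move=> /bounded_opP[TL [M M0 hM]].
have /choice[T' hT'] x : exists v, forall y, ⟪x, T y⟫ = ⟪v, y⟫.
  apply: (@riesz _ _ _ (rnorm x * M)) => [c y y'|y].
    by rewrite TL ipDr ipZr.
  apply: le_trans (cauchy_schwarz _ _) _.
  by rewrite -mulrA ler_wpM2l// rnorm_ge0.
rewrite /adjoint_op; case: xgetP => [T'' _ [//]|/(_ T') []].
split=> //; apply/bounded_opP; split.
  move=> c x y; apply: eq_ipr => z; rewrite ipC -hT' [RHS]ipC; congr Num.conj.
  by rewrite ipDl ipZl hT' ipDl ipZl -!hT'.
exists M => // x; have [->|n0] := eqVneq (rnorm (T' x)) 0.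
  by rewrite mulr_ge0// rnorm_ge0.
have p0 : 0 < rnorm (T' x) by rewrite lt_neqAle eq_sym n0 rnorm_ge0.
rewrite -(ler_pM2l p0) -expr2 rnorm_sqr -hT'.
apply: le_trans (cauchy_schwarz_Re _ _) _.
by have := ler_wpM2l (rnorm_ge0 x) (hM (T' x)); lra.
Qed.

End Adjoint.

(** * Analytic vectors of skew-symmetric graphs *)

(** The rearrangement behind the Cauchy product: pairs are grouped along the antidiagonals
    [k + l = m]. *)
Lemma triangle_sum (V : nmodType) (f : nat -> nat -> V) N :
  \sum_(0 <= k < N) \sum_(0 <= l < N | (k + l < N)%N) f k l =
  \sum_(0 <= m < N) \sum_(0 <= k < m.+1) f k (m - k)%N.
Proof.
transitivity (\sum_(0 <= k < N) \sum_(0 <= m < N | (k <= m)%N) f k (m - k)%N).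
  apply: eq_big_nat => k /andP[_ kN].
  transitivity (\sum_(0 + k <= m < N) f k (m - k)%N).
    rewrite big_addn (big_nat_widen _ _ _ _ _ (leq_subr k N)).
    by apply: eq_big => [l|l _]; rewrite ?addnK//= ltn_subRL.
  by rewrite add0n (big_nat_widenl _ 0).
rewrite (exchange_big_dep_nat predT)//=; apply: eq_big_nat => m /andP[_ mN].
by rewrite [RHS](big_nat_widen _ _ _ _ _ mN).
Qed.

Lemma conj_real_complex (R : realType) (a : R) : Num.conj a%:C = a%:C.
Proof. exact: conjc_real. Qed.

Lemma bin_le_exp2 n k : ('C(n, k) <= 2 ^ n)%N.
Proof.
elim: n k => [|n IH] [|k] //; first by rewrite bin0 expn_gt0.
by rewrite binS expnS mul2n -addnn leq_add.
Qed.

(** Splits factorial growth into a factor for [n] and one for [k], at the cost of a geometric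
    factor. *)
Lemma fact_addn_le n k : ((n + k)`! <= 2 ^ (n + k) * (n`! * k`!))%N.
Proof.
by rewrite -(bin_fact (leq_addr k n)) addKn leq_mul2r bin_le_exp2 orbT.
Qed.

Lemma ler_normc_sum (R : realType) I (r : seq I) (P : pred I) (f : I -> R[i]) :
  normc (\sum_(i <- r | P i) f i) <= \sum_(i <- r | P i) normc (f i).
Proof.
elim/big_rec2: _ => [|i y x _ h]; first by rewrite Normc.normc0.
by apply: le_trans (le_normcD _ _) _; rewrite lerD2l.
Qed.

Section AnalyticVectors.
Variables (R : realType) (H : hilbert R).
Implicit Types (G : set (H * H)) (A : set H).

Definition skew_graph G :=
  forall p q, G p -> G q -> ⟪p.2, q.1⟫ = - ⟪p.1, q.2⟫.

Definition jet G (x : nat -> H) := forall n, G (x n, x n.+1).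

Definition factorial_bound (C rho : R) (x : nat -> H) :=
  forall n, rnorm (x n) <= C * rho ^+ n * n`!%:R.

Lemma graphD G x x' y y' : is_subspace G -> G (x, y) -> G (x', y') ->
  G (x + x', y + y').
Proof. by move=> Gs h h'; exact: (subspaceD Gs h h'). Qed.

Lemma graphZ G c x y : is_subspace G -> G (x, y) -> G (c *: x, c *: y).
Proof. by move=> Gs h; exact: (subspaceZ c Gs h). Qed.

Lemma graphB G x x' y y' : is_subspace G -> G (x, y) -> G (x', y') ->
  G (x - x', y - y').
Proof. by move=> Gs h h'; exact: (subspaceB Gs h h'). Qed.

(** Each use of skew symmetry moves one index from the left entry to the right one and costs a
    sign. *)
Lemma jet_ip G x : skew_graph G -> jet G x ->
  forall k l, ⟪x k, x l⟫ = (-1) ^+ k * ⟪x 0%N, x (k + l)%N⟫.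
Proof.
move=> Gs jx; elim=> [|k IH] l; first by rewrite mul1r.
rewrite (Gs (x k, x k.+1) (x l, x l.+1))//= IH exprS mulN1r mulNr addSnnS.
by [].
Qed.

Definition exp_term (s : R) (x : nat -> H) (k : nat) : H := (s ^+ k / k`!%:R)%:C *: x k.

(** This is (1 - 1)^n / n! expanded by the binomial theorem. *)
Lemma alternating_binomial_sum n : (0 < n)%N ->
  \sum_(0 <= k < n.+1) (-1) ^+ k / (k`!%:R * (n - k)`!%:R) = 0 :> R.
Proof.
move=> n0; have := exprDn 1 (-1 : R) n; rewrite subrr expr0n gtn_eqF//=.
move=> /esym/(congr1 (fun a => a / n`!%:R)); rewrite mul0r mulr_suml => h; rewrite -[RHS]h {h}.
have nf k : k`!%:R != 0 :> R by rewrite pnatr_eq0 -lt0n fact_gt0.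
rewrite big_mkord; apply: eq_bigr => -[k /= kn] _.
rewrite expr1n mul1r.
have -> : n`!%:R = 'C(n, k)%:R * (k`!%:R * (n - k)`!%:R) :> R.
  by rewrite -!natrM bin_fact.
have b0 : 'C(n, k)%:R != 0 :> R by rewrite pnatr_eq0 -lt0n bin_gt0.
by rewrite -mulr_natr; field; rewrite b0 !nf.
Qed.

(** A truncated form of the unitarity of exp(s G). By [jet_ip], the part of degree m > 0 in [s] is a
    multiple of the sum in [alternating_binomial_sum], so only degree 0 survives. *)
Lemma exp_series_ip G x s N : skew_graph G -> jet G x -> (0 < N)%N ->
  \sum_(0 <= m < N) \sum_(0 <= k < m.+1) ⟪exp_term s x k, exp_term s x (m - k)%N⟫
   = ⟪x 0%N, x 0%N⟫.
Proof.
move=> Gs jx; case: N => // N _; rewrite big_nat_recl// big_nat1.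
rewrite /exp_term subnn !fact0 !expr0 divr1 !scale1r big1_seq ?addr0// => m _.
transitivity (\sum_(0 <= k < m.+2) (s ^+ m.+1)%:C * ⟪x 0%N, x m.+1⟫ *
   ((-1) ^+ k / (k`!%:R * (m.+1 - k)`!%:R))%:C); last first.
  by rewrite -mulr_sumr -rmorph_sum alternating_binomial_sum//= mulr0.
apply: eq_big_nat => k /andP[_]; rewrite ltnS => km.
rewrite ipZl ipZr (jet_ip Gs jx) subnKC// conj_real_complex.
have -> : (-1) ^+ k = ((-1) ^+ k)%:C :> R[i] by rewrite rmorphXn rmorphN1.
rewrite [RHS]mulrAC -rmorphM 2!mulrA -2!rmorphM; congr (_%:C * _).
have nf j : j`!%:R != 0 :> R by rewrite pnatr_eq0 -lt0n fact_gt0.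
have -> : s ^+ m.+1 = s ^+ k * s ^+ (m.+1 - k) by rewrite -exprD subnKC.
by field; rewrite !nf.
Qed.

(** The k! from [fact_addn_le] cancels the denominator and leaves the ratio 2 |s| rho <= 1/8, small
    enough to beat the number of terms in [partial_sum_norm]. *)
Lemma jet_geometric G x (C rho s : R) : factorial_bound C rho x ->
  0 <= rho -> `|s| * rho * 16 <= 1 ->
  forall n k, rnorm (exp_term s (fun j => x (n + j)%N) k) <=
    C * (2 * rho) ^+ n * n`!%:R / 8 ^+ k.
Proof.
move=> xb r0 sr n k; rewrite rnormZ normc_real normrM normfV normrX.
rewrite (@ger0_norm _ k`!%:R)//; set t := `|s| in sr *.
have t0 : 0 <= t by exact: normr_ge0.
have C0 : 0 <= C.
  by have := xb 0%N; rewrite expr0 !mulr1; apply: le_trans; exact: rnorm_ge0.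
have nf j : 0 < j`!%:R :> R by rewrite ltr0n fact_gt0.
have sk0 : 0 <= t ^+ k / k`!%:R by rewrite divr_ge0 ?exprn_ge0.
apply: le_trans (ler_wpM2l sk0 (xb (n + k)%N)) _.
have hb : (n + k)`!%:R <= 2 ^+ (n + k) * (n`!%:R * k`!%:R) :> R.
  by rewrite -natrX -!natrM ler_nat fact_addn_le.
apply: le_trans (ler_wpM2l sk0 (ler_wpM2l _ hb)) _.
  by rewrite mulr_ge0// exprn_ge0.
have -> : t ^+ k / k`!%:R * (C * rho ^+ (n + k) *
    (2 ^+ (n + k) * (n`!%:R * k`!%:R))) =
    C * (2 * rho) ^+ n * n`!%:R * (2 * t * rho) ^+ k.
  by rewrite !exprD !exprMn; field; rewrite gt_eqF.
apply: ler_wpM2l; first by rewrite !mulr_ge0 ?exprn_ge0 ?mulr_ge0.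
by rewrite -exprVn lerXn2r ?nnegrE ?mulr_ge0 ?invr_ge0//; lra.
Qed.

(* In [|\sum_(k < N) x k|^2] the terms with [k + l < N] add up to [|x 0|^2] and
   the at most [N^2 <= 4^N] others are bounded by [C^2 / 8^N]. *)
Lemma partial_sum_norm (x : nat -> H) (C : R) N :
  (forall k, rnorm (x k) <= C / 8 ^+ k) ->
  \sum_(0 <= m < N) \sum_(0 <= k < m.+1) ⟪x k, x (m - k)%N⟫ = ⟪x 0%N, x 0%N⟫ ->
  rnorm (\sum_(0 <= k < N) x k) ^+ 2 <= rnorm (x 0%N) ^+ 2 + C ^+ 2 / 2 ^+ N.
Proof.
move=> xb xs; rewrite [in X in X <= _]rnorm_sqr ip_suml.
under eq_bigr do rewrite ip_sumr.
under eq_bigr => k _ do rewrite (bigID (fun l => k + l < N)%N) /=.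
rewrite big_split /= Re_add triangle_sum xs -rnorm_sqr lerD2l.
apply: le_trans (Re_le_normc _) _.
have C0 : 0 <= C.
  by have := xb 0%N; rewrite expr0 divr1; apply: le_trans; exact: rnorm_ge0.
have ub k l : (N <= k + l)%N -> normc ⟪x k, x l⟫ <= C ^+ 2 / 8 ^+ N.
  move=> Nkl; apply: le_trans (cauchy_schwarz _ _) _.
  apply: le_trans (ler_pM (rnorm_ge0 _) (rnorm_ge0 _) (xb _) (xb _)) _.
  rewrite mulrACA -expr2 -invfM -exprD ler_wpM2l ?sqr_ge0//.
  by rewrite lef_pV2 ?posrE ?exprn_gt0// ler_weXn2l// ler1n.
apply: (@le_trans _ _ (\sum_(0 <= k < N) \sum_(0 <= l < N) C ^+ 2 / 8 ^+ N)).
  apply: le_trans (ler_normc_sum _ _ _) _; apply: ler_sum => k _.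
  apply: le_trans (ler_normc_sum _ _ _) _; rewrite big_mkcond; apply: ler_sum => l _.
  case: ltnP => /= kl; last exact: ub.
  by rewrite mulr_ge0 ?sqr_ge0// invr_ge0 exprn_ge0.
rewrite sumr_const_nat subn0 sumr_const_nat subn0 -mulrnA -mulrnAr ler_wpM2l ?sqr_ge0//.
have -> : (8 : R) ^+ N = 2 ^+ N * 4 ^+ N by rewrite -exprMn -natrM.
rewrite -mulr_natl invfM mulrCA ler_piMr ?invr_ge0 ?exprn_ge0//.
rewrite ler_pdivrMr ?exprn_gt0// mul1r -natrX ler_nat.
by rewrite -[4%N]/(2 * 2)%N expnMn leq_mul// ltnW// ltn_expl.
Qed.

(** [x'] is exp(s G) applied to the jet. The rate of convergence belongs to the conclusion because
    pairings of the limit with a fixed vector are computed from the series. *)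
Lemma jet_flow G x (C rho s : R) :
  is_subspace G -> closure G `<=` G -> skew_graph G ->
  jet G x -> factorial_bound C rho x -> 0 <= rho -> `|s| * rho * 16 <= 1 ->
  exists x', [/\ jet G x', forall n, rnorm (x' n) <= rnorm (x n) &
    forall n, exists D : R, forall N,
      rnorm (x' n - \sum_(0 <= k < N) exp_term s (fun j => x (n + j)%N) k)
        <= D / 2 ^+ N].
Proof.
move=> Gs Gcl Gsk jx xb r0 sr; pose u n N :=
  \sum_(0 <= k < N) exp_term s (fun j => x (n + j)%N) k.
pose D n := C * (2 * rho) ^+ n * n`!%:R.
have C0 : 0 <= C.
  by have := xb 0%N; rewrite expr0 !mulr1; apply: le_trans; exact: rnorm_ge0.
have D0 n : 0 <= D n by rewrite !mulr_ge0// exprn_ge0// mulr_ge0.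
have tb n k : rnorm (exp_term s (fun j => x (n + j)%N) k) <= D n / 8 ^+ k.
  exact: jet_geometric.
have /choice[x' hx'] n : exists l, forall N, rnorm (l - u n N) <= 2 * D n / 2 ^+ N.
  apply: geometric_limit => N; rewrite /u big_nat_recr//= addrAC subrr add0r.
  apply: le_trans (tb _ _) _; rewrite ler_wpM2l// lef_pV2 ?posrE ?exprn_gt0//.
  by rewrite lerXn2r ?nnegrE// ler_nat.
exists x'; split => [n|n|n]; last by exists (2 * D n) => N; exact: hx'.
  (* The partial sums for [n] and [n.+1] form pairs of [G] by linearity, and both entries converge,
     so closedness applies. *)
  apply: Gcl; apply/closure_graphP => e e0.
  have [N hN] := half_pow_small (2 * D n + 2 * D n.+1) e0.
  exists (u n N, u n.+1 N).
    rewrite /u; elim: N {hN} => [|N IH].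
      by rewrite !big_geq//; exact: (subspace0 Gs).
    rewrite !big_nat_recr//=; apply: (graphD Gs IH).
    by apply: (graphZ _ Gs); rewrite addSn; exact: jx.
  have p0 : 0 <= 2 ^- N :> R by rewrite invr_ge0 exprn_ge0.
  have := hx' n N; have := hx' n.+1 N; have := D0 n; have := D0 n.+1 => /=.
  by move: hN; rewrite mulrDl => *; split; nra.
have main N : (0 < N)%N -> rnorm (u n N) ^+ 2 <= rnorm (x n) ^+ 2 + D n ^+ 2 / 2 ^+ N.
  move=> N0; have jn : jet G (fun j => x (n + j)%N).
    by move=> k; rewrite addnS; exact: jx.
  have x0 : exp_term s (fun j => x (n + j)%N) 0 = x n.
    by rewrite /exp_term fact0 expr0 divr1 scale1r addn0.
  have := partial_sum_norm (tb n) (N := N); rewrite x0; apply.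
  by rewrite (exp_series_ip s Gsk jn)// addn0.
rewrite -(@ler_pXn2r _ 2) ?nnegrE ?rnorm_ge0//.
apply/ler_addgt0Pl => e e0.
have x'0 : rnorm (x' n) <= 2 * D n.
  by have := hx' n 0%N; rewrite /u big_geq// subr0 expr0 divr1.
(* With [c] = [D n] and [q] = 2^-N, the square of |x' n| exceeds that of |x n| by at most c^2 q / 2
   + 6 c^2 q + c^2 q, which 20 c^2 q dominates. *)
have [N hN] := half_pow_small (20 * D n ^+ 2) e0.
have := main N.+1 isT; have := hx' n N.+1.
set v := u n N.+1; set d := rnorm (x' n - v).
have h1 : rnorm (x' n) <= d + rnorm v by have := ler_rnormD (x' n - v) v; rewrite subrK.
have h2 : rnorm v <= d + rnorm (x' n).
  by have := ler_rnormD (v - x' n) (x' n); rewrite subrK rnormB.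
have := rnorm_ge0 (x' n); have := rnorm_ge0 v; have := rnorm_ge0 (x' n - v).
rewrite -/d.
have -> : 2 ^- N.+1 = 2 ^- N / 2 :> R by rewrite exprS invfM mulrC.
have q1 : 2 ^- N <= 1 :> R by rewrite invf_le1 ?exprn_gt0// exprn_ege1// ler1n.
have q0 : 0 <= 2 ^- N :> R by rewrite invr_ge0 exprn_ge0.
move: hN (D0 n) x'0 h1 h2 q0 q1; set q := 2 ^- N; set a := rnorm (x' n).
set b := rnorm v; set c := D n => hN c0 ac abd bad q0 q1 d0 b0 a0 dc hb.
have dq : d <= c * q by lra.
have cq : c * q <= c by rewrite ler_piMr.
have b3 : b <= 3 * c by lra.
have bd : b * d <= 3 * c * (c * q) by apply: ler_pM.
have dd : d * d <= c * (c * q) by apply: ler_pM => //; lra.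
have aa : a ^+ 2 <= (b + d) ^+ 2 by rewrite lerXn2r ?nnegrE ?addr_ge0//; lra.
nra.
Qed.
End AnalyticVectors.

Lemma bernoulli_ineq (R : realType) (s : R) n : 0 <= s -> 1 + n%:R * s <= (1 + s) ^+ n.
Proof.
move=> s0; elim: n => [|n IH]; first by rewrite mul0r addr0 expr0.
rewrite exprS; apply: le_trans (ler_wpM2l _ IH); last by rewrite addr_ge0.
have n0 : 0 <= n%:R :> R by [].
by rewrite -natr1; nra.
Qed.

(** * Closures of skew graphs and real eigenvectors of the adjoint *)

Section SkewAdjoint.
Variables (R : realType) (H : hilbert R).
Implicit Types (G : set (H * H)) (A : set H).

(** The entries are approximated in turn: the first pair with the second in [G], then the second
    pair with the first already in the closure. *)
Lemma skew_closure G : skew_graph G -> skew_graph (closure G).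
Proof.
move=> Gsk; have half p q : closure G p -> G q -> ⟪p.2, q.1⟫ = - ⟪p.1, q.2⟫.
  move=> /closure_graphP pG Gq; apply/eqP; rewrite -subr_eq0 opprK; apply/eqP.
  apply: normc_le_eps => e e0; set M := 1 + rnorm q.1 + rnorm q.2.
  have M0 : 0 < M by rewrite /M -addrA ltr_wpDr// addr_ge0// rnorm_ge0.
  have [r Gr [h1 h2]] := pG _ (divr_gt0 e0 M0).
  rewrite -(subrK r.1 p.1) -(subrK r.2 p.2) (ipDl (p.1 - _)) (ipDl (p.2 - _)) (Gsk _ _ Gr Gq).
  rewrite -addrA (addrC (- _)) addrK.
  apply: le_trans (le_normcD _ _) _.
  apply: le_trans (lerD (cauchy_schwarz _ _) (cauchy_schwarz _ _)) _.
  have eM : e / M * M = e by rewrite divfK// gt_eqF.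
  have t0 := divr_gt0 e0 M0; rewrite /M in eM t0 h1 h2.
  have := ler_wpM2r (rnorm_ge0 q.1) (ltW h2).
  have := ler_wpM2r (rnorm_ge0 q.2) (ltW h1); lra.
move=> p q Gp /closure_graphP qG; apply/eqP; rewrite -subr_eq0 opprK; apply/eqP.
apply: normc_le_eps => e e0; set M := 1 + rnorm p.1 + rnorm p.2.
have M0 : 0 < M by rewrite /M -addrA ltr_wpDr// addr_ge0// rnorm_ge0.
have [r Gr [h1 h2]] := qG _ (divr_gt0 e0 M0).
rewrite -(subrK r.1 q.1) -(subrK r.2 q.2) (ipDr _ (q.1 - _)) (ipDr _ (q.2 - _)) (half _ _ Gp Gr).
rewrite -addrA (addrC (- _)) addrK.
apply: le_trans (le_normcD _ _) _.
apply: le_trans (lerD (cauchy_schwarz _ _) (cauchy_schwarz _ _)) _.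
have eM : e / M * M = e by rewrite divfK// gt_eqF.
have t0 := divr_gt0 e0 M0; rewrite /M in eM t0 h1 h2.
have := ler_wpM2r (rnorm_ge0 p.1) (ltW h2).
have := ler_wpM2r (rnorm_ge0 p.2) (ltW h1); lra.
Qed.

Lemma closure_graph_subspace G : is_subspace G -> is_subspace (closure G).
Proof.
move=> Gs; split=> [|c p q /closure_graphP pG /closure_graphP qG].
  exact: subset_closure (subspace0 Gs).
apply/closure_graphP => e e0.
have n0 : 0 < 1 + normc c by rewrite ltr_wpDr ?normc_ge0.
have e20 : 0 < e / 2 by rewrite divr_gt0.
have [a Ga [h1 h2]] := pG _ (divr_gt0 e20 n0).
have [b Gb [h3 h4]] := qG _ e20.
exists (c *: a + b); first exact: subspaceZD.
have bound (x x' y y' : H) : rnorm (x - x') < e / 2 / (1 + normc c) ->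
    rnorm (y - y') < e / 2 -> rnorm (c *: x + y - (c *: x' + y')) < e.
  move=> hx hy.
  have -> : c *: x + y - (c *: x' + y') = c *: (x - x') + (y - y').
    by rewrite scalerBr opprD addrACA.
  apply: le_lt_trans (ler_rnormD _ _) _; rewrite rnormZ.
  have : rnorm (x - x') * (1 + normc c) < e / 2 by rewrite -ltr_pdivlMr.
  have := rnorm_ge0 (x - x'); have := normc_ge0 c; nra.
by split; exact: bound.
Qed.

Lemma gdom_subspace G : is_subspace G -> is_subspace (gdom G).
Proof.
move=> Gs; split=> [|c _ _ [[a a'] Ga <-] [[b b'] Gb <-]].
  by exists 0 => //; exact: subspace0.
by exists (c *: a + b, c *: a' + b') => //; exact: (subspaceZD c Gs Ga Gb).
Qed.

(** The difference of two values at [x] is a value at 0, which skew symmetry makes orthogonal to the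
    dense domain. *)
Lemma skew_functional G : is_subspace G -> skew_graph G -> dense (gdom G) ->
  forall x y z, G (x, y) -> G (x, z) -> y = z.
Proof.
move=> Gs Gsk Gd x y z Gxy Gxz; apply/eqP; rewrite -subr_eq0; apply/eqP.
have G0 : G (0, y - z) by rewrite -(subrr x); exact: graphB.
move/(dense_orthoP (gdom_subspace Gs)) : Gd; apply => _ [p Gp <-].
by have /= h := Gsk _ _ G0 Gp; rewrite ipC h ip0l oppr0 rmorph0.
Qed.

(** Flowing for the time [lam * s] multiplies the pairing with [y] by exp(lam^2 s) = e^s >= 1 + s.
    The new jet obeys the same bound with the same [C] and [rho], so the step can be repeated [m]
    times. *)
Lemma eigen_ortho_jet G (y : H) (lam C rho s : R) :
  is_subspace G -> closure G `<=` G -> skew_graph G ->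
  (forall p, G p -> ⟪y, p.2⟫ = lam%:C * ⟪y, p.1⟫) ->
  lam = 1 \/ lam = -1 -> 0 < s -> 0 <= rho -> s * rho * 16 <= 1 ->
  forall m x, jet G x -> factorial_bound C rho x ->
  (1 + s) ^+ m * normc ⟪y, x 0%N⟫ <= rnorm y * C.
Proof.
move=> Gs Gcl Gsk yG lam1 s0 r0 sr.
have lam2 : lam * lam = 1 by case: lam1 => ->; rewrite ?mulrNN mulr1.
have sl : `|lam * s| = s.
  by case: lam1 => ->; rewrite ?mulN1r ?normrN ?mul1r gtr0_norm.
elim=> [|m IH] x jx xb.
  rewrite expr0 mul1r; apply: le_trans (cauchy_schwarz _ _) _.
  rewrite ler_wpM2l ?rnorm_ge0//; apply: le_trans (xb 0%N) _.
  by rewrite expr0 fact0 !mulr1.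
have [|x' [jx' x'x xlim]] := jet_flow Gs Gcl Gsk jx xb r0 (s := lam * s).
  by rewrite sl.
have x'b : factorial_bound C rho x' by move=> n; exact: le_trans (x'x n) (xb n).
apply: le_trans (IH x' jx' x'b); rewrite exprSr -mulrA.
apply: ler_wpM2l; first by rewrite exprn_ge0// addr_ge0// ltW.
have yx n : ⟪y, x n⟫ = (lam ^+ n)%:C * ⟪y, x 0%N⟫.
  elim: n => [|n IHn]; first by rewrite expr0 mul1r.
  by rewrite -[x n.+1]/((x n, x n.+1).2) yG// IHn exprS rmorphM mulrA.
have [D hD] := xlim 0%N; set a := normc _.
apply/ler_addgt0Pl => e e0.
have [N hN] := half_pow_small (rnorm y * D) e0.
have := hD N.+2; set u := \sum_(0 <= k < _) _ => hu.
(* Only the terms of degree 0 and 1 are kept; the order [N.+2] of the partial sum guarantees that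
   both are present. *)
have yu : (1 + s) * a <= normc ⟪y, u⟫.
  have -> : ⟪y, u⟫ = (\sum_(0 <= k < N.+2) s ^+ k / k`!%:R)%:C * ⟪y, x 0%N⟫.
    rewrite /u ip_sumr rmorph_sum mulr_suml; apply: eq_bigr => k _.
    rewrite ipZr yx add0n mulrA -rmorphM; congr (_%:C * _).
    have l2 : lam ^+ k * lam ^+ k = 1 by rewrite -exprMn lam2 expr1n.
    by rewrite exprMn mulrAC -!mulrA (mulrCA (s ^+ k)) !mulrA l2 mul1r.
  rewrite Normc.normcM normc_real ler_wpM2r ?normc_ge0//.
  apply: le_trans (ler_norm _).
  rewrite 2?big_nat_recl// expr0 expr1 fact0 !divr1 addrA lerDl.
  by rewrite sumr_ge0// => i _; rewrite divr_ge0// exprn_ge0// ltW.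
have h1 : normc ⟪y, u⟫ <= normc ⟪y, x' 0%N⟫ + normc ⟪y, u - x' 0%N⟫.
  by apply: le_trans (le_normcD _ _); rewrite -ipDr addrC subrK.
have h2 := cauchy_schwarz y (u - x' 0%N); rewrite rnormB in h2.
have h3 := ler_wpM2l (rnorm_ge0 y) hu.
have D0 : 0 <= D by have := le_trans (rnorm_ge0 _) (hD 0%N); rewrite expr0 divr1.
have h4 : rnorm y * (D / 2 ^+ N.+2) <= rnorm y * D / 2 ^+ N.
  rewrite -mulrA ler_wpM2l ?rnorm_ge0// ler_wpM2l// lef_pV2 ?posrE ?exprn_gt0//.
  by rewrite ler_weXn2l// ?ler1n// -addn2 leq_addr.
lra.
Qed.

(** Were the pairing nonzero, its product with (1 + s)^m would be unbounded in [m] by Bernoulli's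
    inequality. *)
Lemma eigen_ortho_jet0 G (y : H) (lam C rho : R) x :
  is_subspace G -> closure G `<=` G -> skew_graph G ->
  (forall p, G p -> ⟪y, p.2⟫ = lam%:C * ⟪y, p.1⟫) ->
  lam = 1 \/ lam = -1 -> jet G x -> factorial_bound C rho x -> ⟪y, x 0%N⟫ = 0.
Proof.
move=> Gs Gcl Gsk yG lam1 jx xb.
(* A positive rate, whatever the sign of [rho], so that the step [s] = 1 / (16 r) makes sense. *)
pose r := `|rho| + 1; have r0 : 0 < r by rewrite ltr_wpDl.
have C0 : 0 <= C.
  by have := le_trans (rnorm_ge0 _) (xb 0%N); rewrite expr0 !mulr1.
have xb' : factorial_bound C r x.
  move=> n; apply: le_trans (xb n) _; rewrite ler_wpM2r// ler_wpM2l//.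
  apply: le_trans (ler_norm _) _; rewrite normrX lerXn2r ?nnegrE ?(ltW r0)//.
  by rewrite lerDl.
pose s := (16 * r)^-1; have s0 : 0 < s by rewrite invr_gt0 mulr_gt0.
have sr : s * r * 16 <= 1 by rewrite -mulrA (mulrC r) /s mulVf// gt_eqF// mulr_gt0.
have hm m := eigen_ortho_jet Gs Gcl Gsk yG lam1 s0 (ltW r0) sr m jx xb'.
apply/eqP; rewrite -normc_eq0; apply/negPn/negP => n0.
have a0 : 0 < normc ⟪y, x 0%N⟫ by rewrite lt_neqAle normc_ge0 andbT eq_sym.
set a := normc _ in hm a0 n0.
have as0 : 0 < a * s by rewrite mulr_gt0.
have yC0 : 0 <= rnorm y * C / (a * s) by rewrite divr_ge0 ?mulr_ge0 ?rnorm_ge0// ltW.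
have := archi_boundP yC0; set m := Num.bound _; rewrite ltr_pdivrMr// => hb.
have := hm m; have := ler_wpM2r (ltW a0) (bernoulli_ineq m (ltW s0)).
move=> h1 h2; have := le_trans h1 h2; rewrite mulrDl mul1r -mulrA (mulrC s).
by rewrite leNgt => /negP; apply; rewrite (lt_trans hb)// ltrDr.
Qed.
End SkewAdjoint.

(** * Self-adjointness from a total set of analytic vectors *)

Section SelfAdjoint.
Variables (R : realType) (H : hilbert R).
Implicit Types (G : set (H * H)) (A : set (H -> H)).

(** The vectors [x 0%N] are Nelson's analytic vectors. Their totality is phrased through the
    orthogonal complement, the form in which it is proved and used. *)
Definition analytic_total G := forall y : H,
  (forall C rho x, jet G x -> factorial_bound C rho x -> ⟪x 0%N, y⟫ = 0) -> y = 0.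

Lemma analytic_dense_gdom G : is_subspace G -> analytic_total G -> dense (gdom G).
Proof.
move=> Gs Gt; apply/(dense_orthoP (gdom_subspace Gs)) => y yG; apply: Gt.
by move=> C rho x jx _; apply: yG; exists (x 0%N, x 1%N).
Qed.

(** A vector orthogonal to this range is an eigenvector of the adjoint with eigenvalue [lam], in the
    weak sense required by [eigen_ortho_jet0]. *)
Lemma analytic_dense_range G (lam : R) : is_subspace G -> closure G `<=` G ->
  skew_graph G -> analytic_total G -> lam = 1 \/ lam = -1 ->
  dense [set p.2 - lam%:C *: p.1 | p in G].
Proof.
move=> Gs Gcl Gsk Gt lam1; set A := [set _ | _ in _].
have As : is_subspace A.
  split=> [|c _ _ [p Gp <-] [q Gq <-]].
    by exists 0; rewrite ?scaler0 ?subr0//; exact: subspace0.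
  exists (c *: p + q); first exact: subspaceZD.
  rewrite /= scalerBr scalerDr !scalerA mulrC opprD.
  by rewrite -!addrA; congr (_ + _); rewrite addrCA.
apply/(dense_orthoP As) => y yA; apply: Gt => C rho x jx xb.
rewrite ipC (eigen_ortho_jet0 Gs Gcl Gsk _ lam1 jx xb) ?rmorph0// => p Gp.
have : ⟪p.2 - lam%:C *: p.1, y⟫ = 0 by apply: yA; exists p.
rewrite ipC => /(congr1 Num.conj); rewrite conjCK rmorph0 ipBr ipZr.
by move/eqP; rewrite subr_eq0 => /eqP.
Qed.

(* Solving [(G - 1) p ~ -(z + y)] makes [w = y - p] almost orthogonal to the dense
   range of [G + 1], so that [y ~ p]. *)
Lemma gadjoint_skewE G y z : is_subspace G -> closure G `<=` G -> skew_graph G ->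
  analytic_total G -> gadjoint G (y, z) <-> G (y, - z).
Proof.
move=> Gs Gcl Gsk Gt; split=> [adj|Gyz q Gq]; last first.
  by have /= -> := Gsk _ _ Gq Gyz; rewrite ipNr opprK.
apply: (Gcl (y, - z)); apply/closure_graphP => e e0.
(* In the end |w|^2 <= 2 d |w| + d^2 gives |w| <= 3 d, and |w - err| <= 4 d stays below 5 d. *)
pose d := e / 5; have d0 : 0 < d by rewrite divr_gt0.
have := analytic_dense_range Gs Gcl Gsk Gt (or_introl (erefl (1 : R))).
move=> /denseP/(_ (- (z + y)))/closureP/(_ d d0)[_ [p Gp <-]].
rewrite scale1r -rnormN opprB opprK; set err := _ + (z + y) => errd.
pose w := y - p.1.
have wG q : G q -> ⟪q.2 + q.1, w⟫ = ⟪q.1, err⟫.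
  move=> Gq; have e1 : ⟪q.2, y⟫ = ⟪q.1, z⟫ by exact: adj.
  rewrite ipDl /w !ipBr e1 (Gsk _ _ Gq Gp) opprK /err !ipDr ipNr.
  ring.
have := analytic_dense_range Gs Gcl Gsk Gt (or_intror (erefl (-1 : R))).
move=> /denseP/(_ w)/closureP/(_ d d0)[_ [q Gq <-]].
rewrite rmorphN1 scaleN1r opprK => wq.
(* Skew symmetry kills the real part of ⟪q.2, q.1⟫, so adding [q.2] cannot shorten [q.1]. *)
have q1 : rnorm q.1 <= rnorm (q.2 + q.1).
  rewrite -(@ler_pXn2r _ 2) ?nnegrE ?rnorm_ge0// rnormD_sqr.
  have := congr1 (@complex.Re R) (Gsk _ _ Gq Gq).
  rewrite Re_opp (ipC q.1) complexRe_conj; have := sqr_ge0 (rnorm q.2); lra.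
have q2 : rnorm (q.2 + q.1) <= d + rnorm w.
  have := ler_rnormD (q.2 + q.1 - w) w; rewrite subrK rnormB; lra.
have hw : rnorm w ^+ 2 <= d * rnorm w + (d + rnorm w) * d.
  rewrite rnorm_sqr -{1}(subrK (q.2 + q.1) w) ipDl Re_add wG// lerD//.
    apply: le_trans (cauchy_schwarz_Re _ _) _.
    by rewrite ler_wpM2r ?rnorm_ge0// ltW.
  apply: le_trans (cauchy_schwarz_Re _ _) _.
  by apply: ler_pM; rewrite ?rnorm_ge0 ?(le_trans q1)// ltW.
have w3 : rnorm w <= 3 * d.
  rewrite leNgt; apply/negP => h; have := rnorm_ge0 w; nra.
have ed : e = 5 * d by rewrite /d mulrC divfK.
have nw := ler_rnormB w err.
exists p => //=; split; first by rewrite -/w; lra.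
have -> : - z - p.2 = w - err.
  by rewrite /w /err (opprD (p.2 - _)) opprB addrA subrKA opprD addrC subrKA.
lra.
Qed.

Lemma conj_i : Num.conj ('i%C : R[i]) = - 'i%C.
Proof. by apply/eqP; rewrite eq_complex /= oppr0 !eqxx. Qed.

Lemma i_neq0 : 'i%C != 0 :> R[i].
Proof. by rewrite -sqrf_eq0 sqr_i oppr_eq0 oner_eq0. Qed.

Lemma gscale_NiE G x y : gscale (- 'i%C) G (x, y) <-> G (x, 'i%C *: y).
Proof.
have ii : 'i%C * - 'i%C = 1 :> R[i] by rewrite mulrN -expr2 sqr_i opprK.
split=> [[z /= Gz ->]|h]; first by rewrite scalerA ii scale1r.
by exists ('i%C *: y) => //=; rewrite scalerA mulrC ii scale1r.
Qed.

(** The adjoint of [G] is [- G] by [gadjoint_skewE]; conjugation of the scalar -i restores the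
    sign. *)
Lemma skew_self_adjoint G : is_subspace G -> closure G `<=` G -> skew_graph G ->
  analytic_total G -> self_adjoint (gscale (- 'i%C) G).
Proof.
move=> Gs Gcl Gsk Gt; have Gd := analytic_dense_gdom Gs Gt.
have gd : gdom (gscale (- 'i%C) G) = gdom G.
  apply/seteqP; split=> x [[x' y] /=].
    by move=> /gscale_NiE Gy <-; exists (x', 'i%C *: y).
  by move=> Gy <-; exists (x', - 'i%C *: y) => //; exists y.
split; last first.
- apply/seteqP; split=> -[y z]; last first.
    move=> /gscale_NiE Gyz [x g] /gscale_NiE Gxg /=.
    have := Gsk _ _ Gxg Gyz => /=; rewrite ipZl ipZr conj_i mulNr.
    by move/oppr_inj/(mulfI i_neq0).
  move=> adj; apply/gscale_NiE; rewrite -[_ *: _]opprK.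
  apply/(gadjoint_skewE _ _ Gs Gcl Gsk Gt) => -[x g] Gxg /=.
  rewrite ipNr ipZr; have /= <- : ⟪- 'i%C *: g, y⟫ = ⟪x, z⟫.
    by apply: (adj (x, _)); exists g.
  by rewrite ipZl rmorphN [X in - X * _]conj_i opprK mulrA -expr2 sqr_i mulN1r opprK.
- exact: (eq_ind_r (fun D : set H => dense D) Gd gd).
- split; first split.
  + by apply/gscale_NiE; rewrite scaler0; exact: (subspace0 Gs).
  + move=> c [x y] [x' y'] /gscale_NiE h /gscale_NiE h'; apply/gscale_NiE.
    rewrite scalerDr scalerA mulrC -scalerA; exact: (subspaceZD c Gs h h').
  + move=> x y z /gscale_NiE h /gscale_NiE h'.
    have := skew_functional Gs Gsk Gd h h'.
    by apply: scalerI; exact: i_neq0.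
Qed.

End SelfAdjoint.

(** * Operators with bounded commutators *)

Section StarAlgebra.
Variables (R : realType) (H : hilbert R).
Implicit Types (G : set (H * H)) (A : set (H -> H)) (a c : H -> H).

(** [c] is the commutator of [G] with [a]. The condition includes that [a] maps the domain of [G]
    into itself, which makes it stable under composition. *)
Definition derivable_op G a := exists c, [/\ bounded_op a, bounded_op c &
  forall x y, G (x, y) -> G (a x, a y + c x)].

Lemma ip_adjointr a (x y : H) : bounded_op a -> ⟪x, adjoint_op a y⟫ = ⟪a x, y⟫.
Proof. by move=> /adjoint_opP[_ h]; rewrite ipC h -ipC. Qed.

(** By [gadjoint_skewE], membership in [G] can be tested by pairing with [G], so the commutator
    identity passes to adjoints: the adjoint of [c] is the commutator of the adjoint. *)
Lemma derivable_adjoint G a : is_subspace G -> closure G `<=` G -> skew_graph G ->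
  analytic_total G -> derivable_op G a -> derivable_op G (adjoint_op a).
Proof.
move=> Gs Gcl Gsk Gt [c [ab cb ac]].
have [a'b _] := adjoint_opP ab; have [c'b _] := adjoint_opP cb.
exists (adjoint_op c); split=> // x y Gxy.
rewrite -[_ + _]opprK; apply/(gadjoint_skewE _ _ Gs Gcl Gsk Gt) => -[p q] Gpq /=.
have /= := Gsk _ _ (ac _ _ Gpq) Gxy; rewrite ipDl => e.
rewrite ipNr ipDr !ip_adjointr//.
by rewrite opprD -e addrK.
Qed.

Lemma derivable_star_subalgebra G : is_subspace G -> closure G `<=` G ->
  skew_graph G -> analytic_total G -> unital_star_subalgebra (derivable_op G).
Proof.
move=> Gs Gcl Gsk Gt; split.
- by move=> a [c []].
- exists (fun=> 0); split; [exact: bounded_id|exact: bounded_cst0|].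
  by move=> x y; rewrite addr0.
- move=> l a b [c [ab cb ac]] [c' [bb c'b bc']].
  exists (fun x => l *: c x + c' x); split; try exact: bounded_lin.
  move=> x y Gxy; rewrite addrACA -scalerDr.
  exact: (subspaceZD l Gs (ac _ _ Gxy) (bc' _ _ Gxy)).
- move=> a b [c [ab cb ac]] [c' [bb c'b bc']].
  (* The Leibniz rule [G, a b] = a [G, b] + [G, a] b, in the shape of [bounded_lin]. *)
  exists (fun x => 1 *: (a \o c') x + (c \o b) x).
  split; [exact: bounded_comp|by apply: bounded_lin; exact: bounded_comp|].
  move=> x y Gxy /=; rewrite scale1r addrA.
  have aD u v : a (u + v) = a u + a v.
    by rewrite -{1}(scale1r u) ab.1 scale1r.
  by rewrite -aD; exact/ac/bc'.
- by move=> a; exact: derivable_adjoint.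
Qed.

(** The generated algebra is an intersection. Its member [M] is what makes the elements bounded; the
    closure properties hold in each member and hence in the intersection. *)
Lemma star_algebra_gen_unital A M : unital_star_subalgebra M -> A `<=` M ->
  unital_star_subalgebra (star_algebra_gen A) /\ star_algebra_gen A `<=` M.
Proof.
move=> Mu AM; have [Mb Mid _ _ _] := Mu.
have AM' : star_algebra_gen A `<=` M.
  by move=> a; apply; split=> // b [->//|]; exact: AM.
split=> //; split.
- by move=> a /AM'/Mb.
- by move=> B [_ AB]; apply: AB; left.
- move=> c a b ha hb B BA; have [[_ _ Bl _ _] _] := BA.
  by apply: Bl; [exact: ha|exact: hb].
- move=> a b ha hb B BA; have [[_ _ _ Bc _] _] := BA.
  by apply: Bc; [exact: ha|exact: hb].
- move=> a ha B BA; have [[_ _ _ _ Ba] _] := BA; apply: Ba; exact: ha.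
Qed.

(** The domain of the commutator contains that of [G], which [a] preserves, and the bounded
    extension is -i times the commutator [c] of [G] with [a]. *)
Lemma weak_spectral_triple_gen G A : is_subspace G -> closure G `<=` G ->
  skew_graph G -> analytic_total G -> A `<=` derivable_op G ->
  weak_spectral_triple (star_algebra_gen A) (gscale (- 'i%C) G).
Proof.
move=> Gs Gcl Gsk Gt AG.
have [Au AG'] := star_algebra_gen_unital (derivable_star_subalgebra Gs Gcl Gsk Gt) AG.
have Gd := analytic_dense_gdom Gs Gt.
split=> //; first exact: skew_self_adjoint.
move=> a /AG' [c [ab cb ac]].
have aZ l u : a (l *: u) = l *: a u.
  have a0 : a 0 = 0 by have := ab.1 (-1) 0 0; rewrite scaler0 addr0 scaleN1r addNr.
  by rewrite -[l *: u]addr0 ab.1 a0 addr0.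
split.
  apply/denseP => x; have /denseP/(_ x)/closureP h := Gd.
  apply/closureP => e /h [_ [[u v] Guv <-] xu]; exists u => //.
  exists (u, - 'i%C *: (a v + c u) - a (- 'i%C *: v)) => //.
  exists (- 'i%C *: v), (- 'i%C *: (a v + c u)); split=> //=.
    by exists v.
  by exists (a v + c u) => //; exact: ac.
exists (fun x => - 'i%C *: c x + (fun=> 0) x).
  by apply: bounded_lin => //; exact: bounded_cst0.
move=> x z [_ [_ [[u /= Gxu ->] [v /= Gav ->] ->]]].
have -> : v = a u + c x by exact: (skew_functional Gs Gsk Gd Gav (ac _ _ Gxu)).
by rewrite addr0 aZ scalerDr addrAC subrr add0r.
Qed.

End StarAlgebra.

(** The vector representing ⟪y, T x⟫ as a functional of [x] is orthogonal to a total set, hence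
    zero. This exchanges one factor of a tensor at a time for elements of a total set. *)
Lemma total_ortho_image (R : realType) (H1 H2 : hilbert R) (T : H1 -> H2)
    (A : set H1) (y : H2) : bounded_op T -> dense (lspan A) ->
  (forall x, A x -> ⟪T x, y⟫ = 0) -> forall x, ⟪T x, y⟫ = 0.
Proof.
move=> /bounded_opP[TL [M M0 hM]] /total_orthoP At Ay x.
have [|a|v hv] := @riesz _ H1 (fun x => ⟪y, T x⟫) (rnorm y * M).
- by move=> c u v; rewrite TL ipDr ipZr.
- apply: le_trans (cauchy_schwarz _ _) _.
  by rewrite -mulrA ler_wpM2l// rnorm_ge0.
have v0 : v = 0.
  by apply: At => u /Ay uy; rewrite ipC -hv -ipC uy.
by rewrite ipC hv v0 ip0l rmorph0.
Qed.

(** * The amplified generator *)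

Section Graphs.
Variables (R : realType) (H : hilbert R).
Implicit Types (G A : set (H * H)).

Lemma gappP G x : gdom G x -> G (x, gapp G x).
Proof.
move=> [[x' y] Gxy /= <-]; rewrite /gapp.
by case: xgetP => [z _ //|/(_ y)].
Qed.

Lemma gappE G x y : (forall z, G (x, z) -> z = y) -> G (x, y) -> gapp G x = y.
Proof. by move=> h Gxy; apply: h; apply: gappP; exists (x, y). Qed.

Lemma lspan_skew A : skew_graph A -> skew_graph (lspan A).
Proof.
move=> Ask; have half p q : lspan A p -> A q -> ⟪p.2, q.1⟫ = - ⟪p.1, q.2⟫.
  move=> Ap Aq; move: p Ap.
  apply: (@lspan_min _ _ _ [set p | ⟪p.2, q.1⟫ = - ⟪p.1, q.2⟫]) => [|p Ap].
    split=> [|c u v /= hu hv]; first by rewrite /= !ip0l oppr0.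
    by rewrite !ipDl !ipZl hu hv mulrN opprD.
  exact: Ask.
move=> p q Ap; move: q.
apply: (@lspan_min _ _ _ [set q | ⟪p.2, q.1⟫ = - ⟪p.1, q.2⟫]) => [|q Aq].
  split=> [|c u v /= hu hv]; first by rewrite /= !ip0r oppr0.
  by rewrite !ipDr !ipZr hu hv mulrN opprD.
exact: half.
Qed.

End Graphs.

(** * Norms and totality in tensor products *)

Section TensorProduct.
Variables (R : realType) (H1 H2 : hilbert R) (K : tensor_product H1 H2).

Lemma tensDr x y y' : tens K x (y + y') = tens K x y + tens K x y'.
Proof. by have := tens_linearr K x 1 y y'; rewrite !scale1r. Qed.

Lemma tens0l y : tens K 0 y = 0.
Proof. by have := tens_linearl K y (-1) 0 0; rewrite scaler0 addr0 scaleN1r addNr. Qed.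

Lemma tens0r x : tens K x 0 = 0.
Proof. by have := tens_linearr K x (-1) 0 0; rewrite scaler0 addr0 scaleN1r addNr. Qed.

Lemma tensZl c x y : tens K (c *: x) y = c *: tens K x y.
Proof. by have := tens_linearl K y c x 0; rewrite addr0 tens0l addr0. Qed.

Lemma tensZr c x y : tens K x (c *: y) = c *: tens K x y.
Proof. by have := tens_linearr K x c y 0; rewrite addr0 tens0r addr0. Qed.

Lemma rnorm_tens x y : rnorm (tens K x y) = rnorm x * rnorm y.
Proof.
apply/eqP; rewrite -(@eqrXn2 _ 2) ?mulr_ge0 ?rnorm_ge0//.
by apply/eqP/(@complexI R); rewrite -ipxx tens_ip !ipxx exprMn -rmorphM.
Qed.

Lemma tens_total_of (A : set H1) (B : set H2) (z : K) :
  dense (lspan A) -> dense (lspan B) ->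
  (forall x y, A x -> B y -> ⟪tens K x y, z⟫ = 0) -> z = 0.
Proof.
move=> At Bt h.
have bl y : bounded_op (tens K ^~ y).
  apply/bounded_opP; split; first exact: tens_linearl.
  by exists (rnorm y); [exact: rnorm_ge0|move=> x; rewrite rnorm_tens mulrC].
have br x : bounded_op (tens K x).
  apply/bounded_opP; split; first exact: tens_linearr.
  by exists (rnorm x); [exact: rnorm_ge0|move=> y; rewrite rnorm_tens].
have /total_orthoP := @tens_total _ _ _ K; apply => _ [x [y ->]].
apply: (total_ortho_image (bl y) At) => x' Ax'.
by apply: (total_ortho_image (br x') Bt) => y' By'; exact: h.
Qed.

End TensorProduct.

(** The series converges at some r > 0, so its terms there are bounded; [rho] is 1 / r. *)
Lemma radius_of_convergence_bound (R : realType) (a : nat -> R) :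
  (0 < radius_of_convergence a)%E ->
  exists C rho : R, [/\ 0 <= C, 0 <= rho & forall n, `|a n| <= C * rho ^+ n].
Proof.
move=> /ereal_sup_gt[_ [r [r0 ar] <-]]; rewrite lte_fin => rgt0.
have /cvg_series_cvg_0/cvgP/cvg_seq_bounded[M [Mr hM]] := ar.
have /(_ _)/= h := hM (`|M| + 1) (ltr_pwDr ltr01 (ler_norm _)).
exists (`|M| + 1), r^-1; split; rewrite ?addr_ge0 ?invr_ge0// => n.
rewrite exprVn ler_pdivlMr ?exprn_gt0//.
by apply: le_trans (ler_norm _) (h n I).
Qed.
Lemma conj_half (R : realType) : Num.conj (2^-1 : R[i]) = 2^-1.
Proof. by rewrite fmorphV rmorph_nat. Qed.

(** * The tridiagonal operator [L] and its analytic vectors *)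

Section Amplification.
Variables (R : realType) (d : nat) (X : manifold R d) (V : vector_field X).
Variables (H : rkhs X) (Hinf : set H).
Hypothesis h1 : assumption1 V Hinf.
Variables (l2 : ell2 R) (K : tensor_product l2 H).
Local Notation e := (l2_basis l2).
Local Notation gen := (gen V).
Local Notation gen_adj := (gen_adj V).
Local Notation L := (ampl_graph (K := K) V Hinf).

Lemma Hinf_ip f g : Hinf f -> Hinf g -> ⟪gen f, g⟫ = ⟪f, gen_adj g⟫.
Proof.
have [_ [_ _ sub _ _] _] := h1 => /sub[/gappP Gf _] /sub[_ /gappP Gg].
exact: (Gg (f, gen f) Gf).
Qed.

Lemma Hinf_ip_adj f g : Hinf f -> Hinf g -> ⟪gen_adj f, g⟫ = ⟪f, gen g⟫.
Proof. by move=> Hf Hg; rewrite ipC -Hinf_ip// -ipC. Qed.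

Lemma sym_part_ip f g : Hinf f -> Hinf g -> ⟪sym_part V f, g⟫ = ⟪f, sym_part V g⟫.
Proof.
move=> Hf Hg; rewrite ipZl ipZr ipDl ipDr Hinf_ip// Hinf_ip_adj//.
by rewrite conj_half addrC.
Qed.

Lemma skew_part_ip f g : Hinf f -> Hinf g ->
  ⟪skew_part V f, g⟫ = - ⟪f, skew_part V g⟫.
Proof.
move=> Hf Hg; rewrite ipZl ipZr ipBl ipBr Hinf_ip// Hinf_ip_adj//.
by rewrite conj_half -opprB mulrN.
Qed.

Lemma rnorm_basis j : rnorm (e j) = 1.
Proof.
apply/eqP; rewrite -(@eqrXn2 _ 2) ?rnorm_ge0// expr1n; apply/eqP/(@complexI R).
by rewrite -ipxx l2_orthonormal eqxx.
Qed.

Lemma matrix_unitE i j k : @matrix_unit R l2 i j (e k) = (j == k)%:R *: e i.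
Proof. by rewrite /matrix_unit l2_orthonormal. Qed.

(** Only the indices j - 1 and j of the sum contribute, which exhibits [L] as tridiagonal; at [j] =
    0 the lower neighbour is absent. *)
Lemma ampl_basisE j f : ampl_basis V K j f =
  (if j is i.+1 then tens K (e i) (sym_part V f) else 0) +
  tens K (e j) (skew_part V f) - tens K (e j.+1) (sym_part V f).
Proof.
rewrite /ampl_basis; under eq_bigr do rewrite !matrix_unitE !tensZl.
case: j => [|j].
  by rewrite big_ord1 eqxx !scale1r scale0r.
rewrite !big_ord_recr/= !eqxx !scale1r big1 => [|i _].
  rewrite (gtn_eqF (ltnSn j.+1)) (ltn_eqF (ltnSn j)) !scale0r addr0 subr0 !add0r.
  by rewrite addrA.
have ij : (i < j.+1)%N by apply: ltn_trans (ltnSn j); exact: ltn_ord.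
by rewrite !eqSS (ltn_eqF (ltn_ord i)) (ltn_eqF ij) !scale0r subr0 addr0.
Qed.

(** The diagonal entries are skew-symmetric, while the off-diagonal ones are symmetric with opposite
    signs above and below the diagonal. *)
Lemma ampl_gen_skew : skew_graph [set xy | exists j, exists2 f, Hinf f &
  xy = (tens K (e j) f, ampl_basis V K j f)].
Proof.
have predE j f k g : ⟪if j is i.+1 then tens K (e i) f else 0, tens K (e k) g⟫
    = (j == k.+1)%:R * ⟪f, g⟫.
  by case: j => [|i]; rewrite ?ip0l ?mul0r// tens_ip l2_orthonormal eqSS.
move=> _ _ [j [f Hf ->]] [k [g Hg ->]]; rewrite !ampl_basisE /=.
rewrite [⟪tens K (e j) f, _⟫]ipC.
rewrite !(ipBl, ipDl) !predE !tens_ip !l2_orthonormal.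
rewrite !(rmorphB, rmorphD, rmorphM, rmorph_nat) /= -!ipC.
rewrite !(eq_sym k) !(eq_sym k.+1) sym_part_ip// skew_part_ip//.
ring.
Qed.

Lemma ampl_subspace : is_subspace L.
Proof. exact: lspan_subspace. Qed.

Lemma ampl_skew : skew_graph L.
Proof. exact/lspan_skew/ampl_gen_skew. Qed.

Lemma ampl_mem j f : Hinf f -> L (tens K (e j) f, ampl_basis V K j f).
Proof. by move=> Hf; apply: sub_lspan; exists j, f. Qed.

Lemma ampl_total (y : K) :
  (forall j f, Hinf f -> ⟪tens K (e j) f, y⟫ = 0) -> y = 0.
Proof.
move=> h; apply: (tens_total_of (A := range e) (B := Hinf)) => [||_ f [j _ <-]].
- exact: l2_total.
- have [_ [Hs Hd _ _ _] _] := h1; apply/total_orthoP => z zH.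
  by have /(dense_orthoP Hs) := Hd; exact.
- exact: h.
Qed.

Lemma ampl_dense : dense (gdom L).
Proof.
apply/(dense_orthoP (gdom_subspace ampl_subspace)) => y yG.
apply: ampl_total => j f Hf; apply: yG.
by exists (tens K (e j) f, ampl_basis V K j f) => //; exact: ampl_mem.
Qed.

(** [derivation_graph] reads the values of [L] through the choice made by [gapp]; single-valuedness
    fixes that choice. *)
Lemma ampl_gapp x y : L (x, y) -> gapp L x = y.
Proof.
move=> Gxy; apply: gappE => // z Gxz.
exact: (skew_functional ampl_subspace ampl_skew ampl_dense Gxz Gxy).
Qed.

(* [L^n (e_j (x) f)], with the basis of l^2 indexed from 0. *)
Fixpoint ampl_jet n j (f : H) : K := if n is n'.+1 then
    (if j is i.+1 then 2^-1 *: (ampl_jet n' i (gen f) + ampl_jet n' i (gen_adj f))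
     else 0) +
    2^-1 *: (ampl_jet n' j (gen f) - ampl_jet n' j (gen_adj f)) -
    2^-1 *: (ampl_jet n' j.+1 (gen f) + ampl_jet n' j.+1 (gen_adj f))
  else tens K (e j) f.

Lemma ampl_jetS n j f : ampl_jet n.+1 j f =
    (if j is i.+1 then 2^-1 *: (ampl_jet n i (gen f) + ampl_jet n i (gen_adj f))
     else 0) +
    2^-1 *: (ampl_jet n j (gen f) - ampl_jet n j (gen_adj f)) -
    2^-1 *: (ampl_jet n j.+1 (gen f) + ampl_jet n j.+1 (gen_adj f)).
Proof. by []. Qed.

(** The recursion of [ampl_jet] applies the first [L] innermost, at [f], whereas a jet applies the
    last one outermost. Induction over all [j] and [f], with linearity of the graph, bridges the
    two. *)
Lemma ampl_jetP j f : Hinf f -> jet L (fun n => ampl_jet n j f).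
Proof.
have [_ [_ _ _ Hg Ha] _] := h1.
move=> Hf n; elim: n j f Hf => [|n IH] j f Hf.
  suff <- : ampl_basis V K j f = ampl_jet 1 j f by exact: ampl_mem.
  rewrite ampl_basisE /= -scaleN1r /sym_part /skew_part.
  by case: j => [|j]; rewrite !(tensZr, tensDr) scaleN1r -(scaleN1r (gen_adj f)) tensZr scaleN1r.
have Gs := ampl_subspace.
have IHg i := IH i _ (Hg _ Hf); have IHa i := IH i _ (Ha _ Hf).
rewrite (ampl_jetS n) (ampl_jetS n.+1).
apply: (graphB Gs); last by apply: (graphZ _ Gs); exact: (graphD Gs).
apply: (graphD Gs); last by apply: (graphZ _ Gs); exact: (graphB Gs).
case: j => [|j]; first exact: (subspace0 Gs).
by apply: (graphZ _ Gs); exact: (graphD Gs).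
Qed.

Definition word_sum n (f : H) : R := \sum_(eps : n.-tuple bool) rnorm (gen_word V eps f).

Lemma word_sum0 f : word_sum 0 f = rnorm f.
Proof.
by rewrite /word_sum (big_pred1 [tuple])// => t; rewrite [t]tuple0 /= eqxx.
Qed.

Lemma word_sumS n f : word_sum n.+1 f = word_sum n (gen f) + word_sum n (gen_adj f).
Proof.
(* A word is split at its last letter, the one that acts first on [f]. *)
pose h (p : n.-tuple bool * bool) : n.+1.-tuple bool := [tuple of rcons p.1 p.2].
have hbij : bijective h.
  apply: inj_card_bij; last by rewrite card_prod !card_tuple card_bool expnSr.
  move=> [s b] [s' b'] /(congr1 val) /= /rcons_inj[ss bb].
  by congr (_, _) => //; exact: val_inj.
rewrite /word_sum (reindex h) /=; last exact: onW_bij.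
rewrite -(pair_bigA _ (fun (s : n.-tuple bool) (b : bool) => rnorm (gen_word V (rcons s b) f))) /=.
under eq_bigr do rewrite big_bool /gen_word !foldr_rcons.
by rewrite big_split /= addrC.
Qed.

(** Each of the at most three entries has coefficient 1/2 on both letters, and 3/2 <= 2. *)
Lemma ampl_jet_bound n j f : rnorm (ampl_jet n j f) <= 2 ^+ n * word_sum n f.
Proof.
have half2 : normc (2^-1 : R[i]) = 2^-1.
  by rewrite -[2](rmorph_nat (real_complex R)) -fmorphV normc_real ger0_norm.
elim: n j f => [|n IH] j f.
  by rewrite word_sum0 rnorm_tens rnorm_basis !mul1r.
rewrite word_sumS exprS.
have hg i := IH i (gen f); have ha i := IH i (gen_adj f).
set ug := 2 ^+ n * word_sum n (gen f) in hg.
set ua := 2 ^+ n * word_sum n (gen_adj f) in ha.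
have half_add i : rnorm (2^-1 *: (ampl_jet n i (gen f) + ampl_jet n i (gen_adj f)))
    <= 2^-1 * (ug + ua).
  rewrite rnormZ half2 ler_wpM2l//; apply: le_trans (ler_rnormD _ _) _.
  by rewrite lerD.
have half_sub i : rnorm (2^-1 *: (ampl_jet n i (gen f) - ampl_jet n i (gen_adj f)))
    <= 2^-1 * (ug + ua).
  rewrite rnormZ half2 ler_wpM2l//; apply: le_trans (ler_rnormB _ _) _.
  by rewrite lerD.
rewrite -mulrA mulrDr -/ug -/ua.
rewrite ampl_jetS; apply: le_trans (ler_rnormB _ _) _.
have h3 := half_add j.+1; have h2 := half_sub j.
have s0 : 0 <= ug + ua by have := le_trans (rnorm_ge0 _) h3; rewrite pmulr_rge0.
apply: le_trans (lerD (ler_rnormD _ _) (lexx _)) _.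
case: j h2 h3 => [|j] h2 h3; first by rewrite rnorm0; lra.
have h4 := half_add j; lra.
Qed.

(** The radius of convergence bounds [word_sum] by a geometric sequence times n!, and the 2^n of
    [ampl_jet_bound] is absorbed by doubling [rho]. *)
Lemma ampl_analytic j f : Hinf f ->
  exists C rho : R, [/\ 0 <= C, 0 <= rho & factorial_bound C rho (fun n => ampl_jet n j f)].
Proof.
have [_ _ /[apply]] := h1.
move=> /radius_of_convergence_bound[C [rho [C0 r0 hb]]].
exists C, (2 * rho); split; rewrite ?mulr_ge0// => n.
apply: le_trans (ampl_jet_bound n j f) _; rewrite exprMn (mulrCA C) -mulrA.
rewrite ler_wpM2l ?exprn_ge0// -ler_pdivrMr ?ltr0n ?fact_gt0//.
exact: le_trans (ler_norm _) (hb n).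
Qed.

End Amplification.

(** * Symmetric products and the Fock space *)

Section TensorPower.
Variables (R : realType) (H : hilbert R) (n : nat) (T : tensor_power H n).
Implicit Types (u v : 'I_n -> H) (x z : T).

Lemma rnorm_tensn v : rnorm (tensn T v) = \prod_i rnorm (v i).
Proof.
apply/eqP; rewrite -(@eqrXn2 _ 2) ?rnorm_ge0 ?prodr_ge0// => [|i _]; last exact: rnorm_ge0.
apply/eqP/(@complexI R); rewrite -ipxx tensn_ip -prodrXl rmorph_prod.
by apply: eq_bigr => i _; rewrite ipxx.
Qed.

Lemma tensn_total_of (B : set H) z : dense (lspan B) ->
  (forall v, (forall i, B (v i)) -> ⟪tensn T v, z⟫ = 0) -> z = 0.
Proof.
move=> Bt h.
(* In [slots k] the first [k] entries are arbitrary and the others lie in [B]; [total_ortho_image]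
   frees one entry at a time. *)
suff slots k v : (forall i : 'I_n, (k <= i)%N -> B (v i)) -> ⟪tensn T v, z⟫ = 0.
  have /total_orthoP := @tensn_total _ _ _ T; apply => _ [v _ <-].
  by apply: (slots n) => i; rewrite leqNgt ltn_ord.
elim: k v => [|k IH] v vB; first by apply: h => i; exact: vB.
have [kn|nk] := ltnP k n; last first.
  by apply: IH => i ki; have := ltn_ord i; rewrite ltnNge (leq_trans nk).
pose i0 := Ordinal kn; pose S (x : H) : T := tensn T (fun j => if j == i0 then x else v j).
have Sb : bounded_op S.
  apply/bounded_opP; split; first exact: tensn_multilinear.
  exists (\prod_(i | i != i0) rnorm (v i)) => [|x].
    by rewrite prodr_ge0// => i _; exact: rnorm_ge0.
  rewrite rnorm_tensn (bigD1 i0)//= eqxx mulrC ler_wpM2r ?rnorm_ge0//.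
  by rewrite le_eqVlt; apply/orP; left; apply/eqP/eq_bigr => i /negbTE ->.
have -> : tensn T v = S (v i0).
  by congr (tensn T _); apply/funext => j; case: eqP => [->|].
apply: (total_ortho_image Sb Bt) => x Bx; apply: IH => i ki.
case: eqP => // ii0; apply: vB; rewrite ltn_neqAle ki andbT.
by apply/eqP => ki'; apply: ii0; apply: val_inj.
Qed.

Lemma symmetric_tensors_subspace : is_subspace (symmetric_tensors T).
Proof.
split=> [s v|c x y hx hy s v]; first by rewrite !ip0r.
by rewrite !ipDr !ipZr hx hy.
Qed.

Lemma symmetric_tensors_closed : closure (symmetric_tensors T) `<=` symmetric_tensors T.
Proof.
move=> x xcl s v; apply/eqP; rewrite -subr_eq0 -ipBl ipC.
rewrite (@ip_closure_eq0 _ _ (symmetric_tensors T))// ?rmorph0// => y ysym.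
by rewrite ipC ipBl ysym subrr rmorph0.
Qed.

Lemma ip_tensn_vee u v : ⟪tensn T u, vee_tens T v⟫ =
  n`!%:R^-1 * \sum_(s : 'S_n) \prod_i ⟪u i, v (s i)⟫.
Proof.
rewrite /vee_tens ipZr ip_sumr; congr (_ * _).
by apply: eq_bigr => s _; rewrite tensn_ip.
Qed.

Lemma vee_symmetric v : symmetric_tensors T (vee_tens T v).
Proof.
move=> s u; rewrite !ip_tensn_vee; congr (_ * _).
rewrite (reindex_inj (mulgI s)) /=; apply: eq_bigr => t _.
by rewrite [RHS](reindex_inj (@perm_inj _ s)); apply: eq_bigr => i _; rewrite permM.
Qed.

(** Against a symmetric tensor all n! permuted inner products agree, so their average equals each of
    them. *)
Lemma ip_vee_symmetric v x : symmetric_tensors T x -> ⟪vee_tens T v, x⟫ = ⟪tensn T v, x⟫.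
Proof.
move=> xs; rewrite /vee_tens ipZl ip_suml; under eq_bigr do rewrite xs.
by rewrite sumr_const card_Sn -[X in _ * X]mulr_natl mulrA fmorphV rmorph_nat mulVf ?mul1r.
Qed.

Lemma rnorm_vee v : rnorm (vee_tens T v) <= \prod_i rnorm (v i).
Proof.
have f0 : 0 < n`!%:R :> R by rewrite ltr0n fact_gt0.
have -> : vee_tens T v = (n`!%:R^-1)%:C *: \sum_(s : 'S_n) tensn T (fun i => v (s i)).
  by rewrite fmorphV rmorph_nat.
rewrite rnormZ normc_real ger0_norm ?invr_ge0 ?(ltW f0)// ler_pdivrMl//.
apply: le_trans (ler_rnorm_sum _ _ _) _.
rewrite mulr_natl -card_Sn -sumr_const le_eqVlt; apply/orP; left; apply/eqP.
apply: eq_bigr => s _.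
by rewrite rnorm_tensn [RHS](reindex_inj (@perm_inj _ s)).
Qed.

(** The residual of the projection onto the closed span is itself symmetric, so being orthogonal to
    symmetrised tensors it is orthogonal to the plain ones, which are total. *)
Lemma symmetric_vee_dense (B : set H) : dense (lspan B) -> symmetric_tensors T `<=`
  closure (lspan [set vee_tens T v | v in [set v | forall i, B (v i)]]).
Proof.
move=> Bt x xs; set A := lspan _.
have As : is_subspace A by exact: lspan_subspace.
have Asym : A `<=` symmetric_tensors T.
  apply: lspan_min; first exact: symmetric_tensors_subspace.
  by move=> _ [v _ <-]; exact: vee_symmetric.
have [l Al hl] := orthogonal_projection x (closure_subspace As) (@closed_closure _ _).
have ls : symmetric_tensors T l.
  by apply: symmetric_tensors_closed; apply: closure_subset Al.
suff x0 : x - l = 0 by rewrite -(subrK l x) x0 add0r.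
apply: (tensn_total_of Bt) => v vB.
rewrite -ip_vee_symmetric; last exact: (subspaceB symmetric_tensors_subspace).
by apply: hl; apply: sub_closure; apply: sub_lspan; exists v.
Qed.

End TensorPower.

(** * Symmetric products in Fock space and skew symmetry of the derivation *)

Section FockSpace.
Variables (R : realType) (H : hilbert R) (T : forall n, tensor_power H n).
Variables (w : nat -> R) (F : fock_space T w).

Lemma fock_inB n (x y : T n) : fock_in F (x - y) = fock_in F x - fock_in F y.
Proof. by rewrite addrC -scaleN1r fock_in_linear scaleN1r addrC. Qed.

Lemma fock_in0 n : fock_in F (0 : T n) = 0.
Proof. by rewrite -(subrr (0 : T n)) fock_inB subrr. Qed.

Lemma rnorm_fock_in n (x : T n) : symmetric_tensors (T n) x ->
  rnorm (fock_in F x) = `|w n| * rnorm x.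
Proof.
move=> xs; apply/eqP; rewrite -(@eqrXn2 _ 2) ?mulr_ge0 ?rnorm_ge0//.
apply/eqP/(@complexI R); rewrite -ipxx fock_in_ip// ipxx -rmorphM.
by rewrite exprMn real_normK// num_real.
Qed.

Lemma symprodE s n : size s = n ->
  symprod F s = fock_in F (vee_tens (T n) (fun i => s`_i)).
Proof. by case: n /. Qed.

Lemma ip_symprod s s' n : size s = n -> size s' = n ->
  ⟪symprod F s, symprod F s'⟫ = (w n ^+ 2)%:C *
    (n`!%:R^-1 * \sum_(t : 'S_n) \prod_(i < n) ⟪s`_i, s'`_(t i)⟫).
Proof.
move=> sn s'n; rewrite (symprodE sn) (symprodE s'n) fock_in_ip; try exact: vee_symmetric.
by rewrite ip_vee_symmetric ?ip_tensn_vee//; exact: vee_symmetric.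
Qed.

Lemma ip_symprod_neq s s' : size s <> size s' -> ⟪symprod F s, symprod F s'⟫ = 0.
Proof. by move=> ss; apply: fock_in_orthogonal => //; exact: vee_symmetric. Qed.

Lemma rnorm_symprod s :
  rnorm (symprod F s) <= `|w (size s)| * \prod_(i < size s) rnorm s`_i.
Proof.
rewrite rnorm_fock_in; last exact: vee_symmetric.
by rewrite ler_wpM2l//; exact: rnorm_vee.
Qed.

Lemma symprod_total (B : set H) (y : F) : dense (lspan B) ->
  (forall s, (forall x, x \in s -> B x) -> ⟪symprod F s, y⟫ = 0) -> y = 0.
Proof.
move=> Bt h; have /total_orthoP := @fock_in_total _ _ _ _ F; apply => _ [n [x xs ->]].
set V := [set vee_tens (T n) v | v in [set v | forall i, B (v i)]].
(* The norm of [fock_in] is controlled on symmetric tensors only, so symmetry is carried along the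
   span. *)
have Vy z : lspan V z -> symmetric_tensors (T n) z /\ ⟪fock_in F z, y⟫ = 0.
  move: z; apply: lspan_min => [|_ [v vB <-]].
    split=> [|c u v [us uy] [vs vy]].
      by split; [exact: (subspace0 (symmetric_tensors_subspace _))|rewrite fock_in0 ip0l].
    split; first exact: (subspaceZD c (symmetric_tensors_subspace _) us vs).
    by rewrite fock_in_linear ipDl ipZl uy vy mulr0 addr0.
  split; first exact: vee_symmetric.
  pose s := [tuple v i | i < n].
  rewrite (_ : vee_tens (T n) v = vee_tens (T n) (fun i => s`_i)).
    rewrite -(symprodE (size_tuple s)); apply: h => z /tnthP[i ->].
    by rewrite tnth_mktuple; exact: vB.
  congr (vee_tens _ _); apply/funext => i.
  by rewrite -tnth_nth tnth_mktuple.
apply: normc_le_eps => e e0; have /closureP xV := symmetric_vee_dense Bt xs.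
pose M := 1 + `|w n| * rnorm y.
have M0 : 0 < M by rewrite ltr_wpDr// mulr_ge0// rnorm_ge0.
have [a /Vy[as_ ay] xa] := xV _ (divr_gt0 e0 M0).
have -> : ⟪fock_in F x, y⟫ = ⟪fock_in F (x - a), y⟫ by rewrite fock_inB ipBl ay subr0.
apply: le_trans (cauchy_schwarz _ _) _.
rewrite rnorm_fock_in; last exact: (subspaceB (symmetric_tensors_subspace _)).
have := rnorm_ge0 (x - a); move: xa; rewrite ltr_pdivlMr// /M.
by rewrite -mulrA (mulrCA _ (rnorm (x - a))); lra.
Qed.

Variables (L : set (H * H)).
Hypothesis Lskew : skew_graph L.
Hypothesis Lfun : forall x y, L (x, y) -> gapp L x = y.

Definition derivation_on_gens (s : seq H) : F :=
  \sum_(i < size s) symprod F (set_nth 0 s i (gapp L s`_i)).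

Lemma nth_set (s : seq H) (i k : nat) y : (set_nth 0 s i y)`_k = if k == i then y else s`_k.
Proof. by rewrite nth_set_nth. Qed.

Lemma size_set (s : seq H) i y : (i < size s)%N -> size (set_nth 0 s i y) = size s.
Proof. by rewrite size_set_nth => /maxn_idPr. Qed.

(** The inner products are permanents. In the summand of a permutation [t], [L] on the left factor
    [i] is matched with [L] on the right factor [t i], and skew symmetry of [L] changes the sign of
    that one factor. *)
Lemma derivation_gen_skew (s s' : seq H) :
  (forall x, x \in s -> gdom L x) -> (forall x, x \in s' -> gdom L x) ->
  ⟪derivation_on_gens s, symprod F s'⟫ = - ⟪symprod F s, derivation_on_gens s'⟫.
Proof.
move=> sL s'L; rewrite /derivation_on_gens ip_suml ip_sumr.
have [ss|ss] := eqVneq (size s) (size s'); last first.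
  rewrite !big1 ?oppr0// => i _; apply: ip_symprod_neq.
    by rewrite size_set//; apply/eqP.
  by rewrite size_set//; apply/eqP.
pose n := size s'; rewrite -/n in ss *; rewrite ss.
under eq_bigr => i _.
  rewrite (@ip_symprod _ _ n) ?size_set ?ss//; under eq_bigr do under eq_bigr do rewrite nth_set.
  over.
rewrite -!mulr_sumr [in RHS](eq_bigr (fun j : 'I_n => (w n ^+ 2)%:C * (n`!%:R^-1 *
  \sum_(t : 'S_n) \prod_(k < n) ⟪s`_k, if t k == j then gapp L s'`_j else s'`_(t k)⟫))).
  rewrite -!mulr_sumr -!mulrN; congr (_ * (_ * _)).
  rewrite exchange_big [in RHS]exchange_big -sumrN; apply: eq_bigr => t _.
  rewrite [in RHS](reindex_inj (@perm_inj _ t)) -sumrN; apply: eq_bigr => i _.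
  rewrite (bigD1 i)//= [in RHS](bigD1 i)//= !eqxx -mulNr; congr (_ * _).
    have Ls : L (s`_i, gapp L s`_i) by apply: gappP; apply: sL; rewrite mem_nth// ss.
    have Ls' : L (s'`_(t i), gapp L s'`_(t i)) by apply: gappP; apply: s'L; rewrite mem_nth.
    exact: Lskew Ls Ls'.
  apply: eq_bigr => k ki; rewrite (inj_eq (@perm_inj _ t)).
  by rewrite (negbTE ki) -[(k : nat) == i]/(k == i) (negbTE ki).
move=> j _; rewrite (@ip_symprod _ _ n) ?size_set//.
by under eq_bigr do under eq_bigr do rewrite nth_set.
Qed.

Lemma derivation_subspace : is_subspace (derivation_graph F L).
Proof. exact: lspan_subspace. Qed.

Lemma derivation_skew : skew_graph (derivation_graph F L).
Proof.
apply: lspan_skew => _ _ [s sL ->] [s' s'L ->] /=; exact: derivation_gen_skew.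
Qed.

End FockSpace.

(** * Rising factorials m (m + 1) ... (m + k - 1) and jets in Fock space *)

Fixpoint rising (m k : nat) : nat := if k is k'.+1 then m * rising m.+1 k' else 1.

Lemma rising_fact m k : (rising m.+1 k * m`! = (m + k)`!)%N.
Proof.
elim: k m => [|k IH] m; first by rewrite mul1n addn0.
by rewrite [rising _ _]/= mulnAC -factS mulnC IH addSnnS.
Qed.

Lemma rising_le m k : (rising m k * m`! <= (m + k)`!)%N.
Proof.
elim: k m => [|k IH] m; first by rewrite mul1n addn0.
rewrite addnS -addSn; apply: leq_trans (IH m.+1).
by rewrite [rising _ k.+1]/= factS (mulnC m) -mulnA leq_mul2l leq_mul2r leqnSn !orbT.
Qed.

Lemma rising_exp_le m k : (rising m k <= 2 ^ (m + k) * k`!)%N.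
Proof.
rewrite -(leq_pmul2r (fact_gt0 m)) (leq_trans (rising_le m k))//.
by rewrite -mulnA (mulnC k`!) fact_addn_le.
Qed.

Lemma graph_sum (R : realType) (H : hilbert R) (G : set (H * H)) I (r : seq I)
    (P : pred I) (f g : I -> H) : is_subspace G ->
  (forall i, P i -> G (f i, g i)) ->
  G (\sum_(i <- r | P i) f i, \sum_(i <- r | P i) g i).
Proof.
move=> Gs h; apply: (big_rec2 (fun x y => G (x, y))); first exact: (subspace0 Gs).
by move=> i x y Pi Gxy; apply: (graphD Gs) => //; exact: h.
Qed.

Section FockJets.
Variables (R : realType) (H : hilbert R) (T : forall n, tensor_power H n).
Variables (w : nat -> R) (F : fock_space T w).
Variables (L : set (H * H)).
Hypothesis Lfun : forall x y, L (x, y) -> gapp L x = y.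
Local Notation D := (derivation_graph F L).
Local Notation nthx := (nth (fun _ : nat => 0 : H)).

(** With the entries read as sequences of iterates of [L], this applies [L] to the [i]-th factor. *)
Definition shift_at (X : seq (nat -> H)) i : seq (nat -> H) :=
  set_nth (fun=> 0) X i (fun k => nthx X i k.+1).

(* The [N]-th iterate of the derivation at the product of the [x 0], with [x k] in
   the role of [L^k (x 0)]. *)
Fixpoint fock_jet N (X : seq (nat -> H)) : F :=
  if N is N'.+1 then \sum_(i < size X) fock_jet N' (shift_at X i)
  else symprod F [seq x 0%N | x <- X].

Lemma size_shift X i : (i < size X)%N -> size (shift_at X i) = size X.
Proof. by rewrite size_set_nth => /maxn_idPr. Qed.

Lemma nth_shift X i j k :
  nthx (shift_at X i) j k = if j == i then nthx X i k.+1 else nthx X j k.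
Proof. by rewrite nth_set_nth /=; case: eqP. Qed.

(** Order 0 is the defining rule of the derivation, with [Lfun] identifying the value chosen by
    [gapp]; higher orders are sums of shifted jets. *)
Lemma fock_jetP X : (forall i, (i < size X)%N -> jet L (nthx X i)) ->
  jet D (fun N => fock_jet N X).
Proof.
move=> jX N; elim: N X jX => [|N IH] X jX; last first.
  rewrite [fock_jet N.+1 X]/= [fock_jet N.+2 X]/=.
  have : forall i : 'I_(size X), D (fock_jet N (shift_at X i), fock_jet N.+1 (shift_at X i)).
    move=> i; apply: IH => j; rewrite size_shift// => jX' k.
    by rewrite !nth_shift; case: eqP => _; exact: jX.
  by move=> h; apply: (graph_sum _ (derivation_subspace F L)).
apply: sub_lspan; exists [seq x 0%N | x <- X].
  move=> v vX; have := vX; rewrite -index_mem size_map => /jX/(_ 0%N) Lv.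
  exists (nthx X (index v [seq x 0%N | x <- X]) 0%N, nthx X (index v [seq x 0%N | x <- X]) 1%N) => //=.
  by rewrite -[RHS](nth_index (0 : H) vX) (nth_map (fun=> 0))// -[X in (_ < X)%N](size_map (fun x => x 0%N)) index_mem.
congr (_, _); rewrite /= size_map; apply: eq_bigr => i _; congr (symprod F _).
apply: (@eq_from_nth _ 0); rewrite ?size_set ?size_map ?size_shift// => k kX.
rewrite nth_set (nth_map (fun=> 0)) ?size_shift// nth_shift.
case: eqP => // [_|_]; last by rewrite (nth_map (fun=> 0)).
by rewrite (nth_map (fun=> 0))// (Lfun (jX i _ 0%N)).
Qed.

(* The bounds on the factors are stated with rising factorials because this shape
   is stable: replacing [x i] by its shift multiplies [c i] by [rho * m i] and
   increments [m i], and summing over [i] gives [\sum_i m i] exactly. *)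
Lemma fock_jet_bound rho N X (c : nat -> R) (m : nat -> nat) :
  (forall i k, (i < size X)%N -> rnorm (nthx X i k) <= c i * rho ^+ k * (rising (m i) k)%:R) ->
  rnorm (fock_jet N X) <= `|w (size X)| * \prod_(i < size X) c i * rho ^+ N *
    (rising (\sum_(i < size X) m i) N)%:R.
Proof.
elim: N X c m => [|N IH] X c m Xb.
  rewrite expr0 !mulr1; apply: le_trans (rnorm_symprod _ _) _; rewrite size_map.
  rewrite ler_wpM2l//; apply: ler_prod => i _; rewrite rnorm_ge0/= (nth_map (fun=> 0))//.
  by apply: le_trans (Xb i 0%N _) _ => //; rewrite expr0 !mulr1.
rewrite [fock_jet _ _]/=; apply: le_trans (ler_rnorm_sum _ _ _) _.
set n := size X; set M := (\sum_(i < n) m i)%N.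
set P := \prod_(i < n) c i.
have -> : `|w n| * P * rho ^+ N.+1 * (rising M N.+1)%:R =
  \sum_(i < n) `|w n| * P * rho ^+ N.+1 * (m i)%:R * (rising M.+1 N)%:R.
  rewrite -mulr_suml -mulr_sumr -natr_sum -/M [rising M N.+1]/= natrM.
  by rewrite !mulrA.
apply: ler_sum => i _.
pose c' j := if j == i :> nat then c i * rho * (m i)%:R else c j.
pose m' j := if j == i :> nat then (m i).+1 else m j.
have /IH : forall j k, (j < size (shift_at X i))%N ->
    rnorm (nthx (shift_at X i) j k) <= c' j * rho ^+ k * (rising (m' j) k)%:R.
  move=> j k; rewrite size_shift// => jX; rewrite nth_shift /c' /m'.
  case: eqP => _; last exact: Xb.
  apply: le_trans (Xb i k.+1 _) _ => //.
  by rewrite [rising _ _]/= natrM exprS !mulrA -(mulrA _ (rho ^+ k)) (mulrC (rho ^+ k)) !mulrA.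
rewrite size_shift// -/n => /le_trans; apply.
have -> : (\sum_(j < n) m' j)%N = M.+1.
  rewrite /M (bigD1 i)//= /m' eqxx [in RHS](bigD1 i)//= addSn; congr (_ + _).+1.
  by apply: eq_bigr => j; rewrite -val_eqE => /negbTE /= ->.
have -> : \prod_(j < n) c' j = P * rho * (m i)%:R.
  rewrite /P (bigD1 i)//= /c' eqxx [in RHS](bigD1 i)//=.
  rewrite (eq_bigr (fun j : 'I_n => c j)) => [|j]; first by ring.
  by rewrite -val_eqE => /negbTE /= ->.
by rewrite exprS le_eqVlt; apply/orP; left; apply/eqP; ring.
Qed.

Lemma fock_jet_factorial C rho X : 0 <= C -> 0 <= rho ->
  (forall i, (i < size X)%N -> factorial_bound C rho (nthx X i)) ->
  exists C' rho', factorial_bound C' rho' (fun N => fock_jet N X).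
Proof.
move=> C0 r0 Xb; set n := size X.
exists (`|w n| * C ^+ n * 2 ^+ n), (2 * rho) => N.
(* All [m i] are 1, since the rising factorial of 1 is k!; their sum is then the number [n] of
   factors. *)
apply: le_trans (@fock_jet_bound rho N X (fun=> C) (fun=> 1%N) _) _.
  move=> i k iX; have := rising_fact 0 k; rewrite fact0 muln1 add0n => ->.
  exact: Xb.
rewrite -/n prodr_const sum_nat_const card_ord muln1.
have : (rising n N)%:R <= 2 ^+ (n + N) * N`!%:R :> R.
  by rewrite -natrX -natrM ler_nat rising_exp_le.
have w0 : 0 <= `|w n| * C ^+ n * rho ^+ N by rewrite !mulr_ge0 ?exprn_ge0.
move=> /(ler_wpM2l w0)/le_trans; apply.
rewrite exprD exprMn; move: (C ^+ n) (2 ^+ n : R) (2 ^+ N : R) (rho ^+ N) (N`!%:R : R) => a b c r k.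
by rewrite le_eqVlt; apply/orP; left; apply/eqP; ring.
Qed.

Variable B : set H.
Hypothesis Btot : dense (lspan B).
Hypothesis Banalytic : forall b, B b -> exists x C rho,
  [/\ jet L x, x 0%N = b, 0 <= C, 0 <= rho & factorial_bound C rho x].

Lemma analytic_list s : (forall b, b \in s -> B b) ->
  exists X C rho, [/\ [seq x 0%N | x <- X] = s, 0 <= C, 0 <= rho &
    forall i, (i < size X)%N -> jet L (nthx X i) /\ factorial_bound C rho (nthx X i)].
Proof.
elim: s => [|b s IH] sB; first by exists [::], 0, 0.
have [|X [C [rho [Xs C0 r0 hX]]]] := IH.
  by move=> x xs; apply: sB; rewrite in_cons xs orbT.
have [x [C' [rho' [jx xb C'0 r'0 hx]]]] := Banalytic (sB b (mem_head _ _)).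
(* Adding the constants gives one bound that serves every factor of the list. *)
exists (x :: X), (C + C'), (rho + rho'); split; rewrite ?addr_ge0//=.
  by rewrite xb Xs.
have mono (y : nat -> H) (a a' r r' : R) : 0 <= r -> a <= a' -> r <= r' -> 0 <= a ->
    factorial_bound a r y -> factorial_bound a' r' y.
  move=> r1 aa rr a0 h k; apply: le_trans (h k) _; rewrite ler_wpM2r//.
  by rewrite ler_pM ?exprn_ge0// lerXn2r ?nnegrE// (le_trans r1).
case=> [_|i iX] /=.
  by split=> //; apply: mono hx; rewrite // lerDr.
have [ji hi] := hX i iX; split=> //.
by apply: mono hi; rewrite // lerDl.
Qed.

Lemma fock_analytic_total : analytic_total D.
Proof.
move=> y yD; apply: (symprod_total Btot) => s /analytic_list[X [C [rho [<- C0 r0 hX]]]].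
have [C' [rho' hb]] := fock_jet_factorial C0 r0 (fun i iX => (hX i iX).2).
exact: (yD _ _ _ (fock_jetP (fun i iX => (hX i iX).1)) hb).
Qed.

(* The existence of the multiplication of [F] is not needed: if there were none,
   [fock_mul] would be its default value 0, and so would the creation operators. *)
Lemma creation_bounded u : bounded_op (creation u : F -> F).
Proof.
rewrite /creation /fock_mul; case: xgetP => [m _ [_ mr [M hM] _]|_]; last first.
  exact: bounded_cst0.
split; first exact: mr.
by exists (M * `|symprod F [:: u]|) => x; exact: hM.
Qed.

(** On generators this is the Leibniz rule for the product with [u]; both sides are linear in the
    pair, so it extends to the span. *)
Lemma creation_derivation u u' x y : L (u, u') -> D (x, y) ->
  D (creation u x, creation u y + creation u' x).
Proof.
move=> Lu; rewrite /creation /fock_mul; case: xgetP => [m _ [_ mr _ ms]|_]; last first.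
  by rewrite addr0 => _; exact: (subspace0 (derivation_subspace F L)).
pose P := [set p : F * F | D (m (symprod F [:: u]) p.1,
  m (symprod F [:: u]) p.2 + m (symprod F [:: u']) p.1)].
suff : D `<=` P by move=> /[apply].
apply: lspan_min => [|_ [s sL ->]].
  have m0 z : m z 0 = 0.
    by have := mr z (-1) 0 0; rewrite scaler0 addr0 scaleN1r addNr.
  split=> [|c [p1 p2] [q1 q2] hp hq]; rewrite /P /=.
    by rewrite !m0 addr0; exact: (subspace0 (derivation_subspace F L)).
  rewrite !mr addrACA -scalerDr.
  exact: (subspaceZD c (derivation_subspace F L) hp hq).
apply: sub_lspan; exists (u :: s).
  by move=> v; rewrite in_cons => /predU1P[->|/sL//]; exists (u, u').
(* The first summand, where [L] hits the new head [u], is the term of [creation u']; the others form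
   [creation u] of the derivation. *)
rewrite /= !ms; congr (_, _); rewrite big_ord_recl /= (Lfun Lu) addrC; congr (_ + _).
have mD z a b : m z (a + b) = m z a + m z b by have := mr z 1 a b; rewrite !scale1r.
have m0 z : m z 0 = 0 by have := mr z (-1) 0 0; rewrite scaler0 addr0 scaleN1r addNr.
rewrite (big_morph _ (mD _) (m0 _)); apply: eq_bigr => i _; exact: ms.
Qed.

End FockJets.

(** * Passage to the closure and assembly of the spectral triple *)

Lemma closure_derivable (R : realType) (H : hilbert R) (G : set (H * H)) (a c : H -> H) :
  bounded_op a -> bounded_op c ->
  (forall x y, G (x, y) -> G (a x, a y + c x)) -> derivable_op (closure G) a.
Proof.
move=> ab cb ac; exists c; split=> // x y /closure_graphP xyG.
have opB (b : H -> H) u v : bounded_op b -> b (u - v) = b u - b v.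
  by move=> [bl _]; rewrite addrC -scaleN1r bl scaleN1r addrC.
have /bounded_opP[_ [M M0 hM]] := ab; have /bounded_opP[_ [M' M'0 hM']] := cb.
(* [K] exceeds M + M', the bound for the second entry [a y + c x], where both operators act. *)
apply/closure_graphP => e e0; pose K := 1 + M + M'.
have K0 : 0 < K by rewrite /K -addrA ltr_wpDr// addr_ge0.
have [[x' y'] Gxy /= [hx hy]] := xyG _ (divr_gt0 e0 K0).
exists (a x', a y' + c x'); first exact: ac.
have eK : e / K * K = e by rewrite divfK// gt_eqF.
have d0 := divr_gt0 e0 K0; move: hx hy eK d0; set d := e / K => hx hy eK d0.
have h1 : M * rnorm (x - x') <= M * d by rewrite ler_wpM2l// ltW.
have h2 : M * rnorm (y - y') <= M * d by rewrite ler_wpM2l// ltW.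
have h3 : M' * rnorm (x - x') <= M' * d by rewrite ler_wpM2l// ltW.
have M'd : 0 <= M' * d by rewrite mulr_ge0// ltW.
rewrite /K in eK; split=> /=.
  rewrite -opB//; apply: le_lt_trans (hM _) _; lra.
rewrite opprD addrACA -!opB//; apply: le_lt_trans (ler_rnormD _ _) _.
have := hM (y - y'); have := hM' (x - x'); lra.
Qed.
Lemma analytic_totalS (R : realType) (H : hilbert R) (G G' : set (H * H)) :
  G `<=` G' -> analytic_total G -> analytic_total G'.
Proof.
by move=> GG' Gt y yG; apply: Gt => C rho x jx xb; apply: yG xb => n; exact: GG'.
Qed.

Theorem theorem18 (R : realType) (d : nat) (X : manifold R d)
    (V : vector_field X) (Phi : R -> X -> X)
    (hPhi : generates_flow V Phi)
    (H : rkhs X) (hk : strictly_positive_definite (rk_kernel H))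
    (Hinf : set H) (h1 : assumption1 V Hinf)
    (HH : tensor_product H H) (S : set H) (h2 : assumption2 HH Hinf S)
    (l2 : ell2 R) (K : tensor_product l2 H)
    (T : forall n : nat, tensor_power K n)
    (tau p : R) (htau : 0 < tau) (hp : 0 < p < 1)
    (F : fock_space T (subexp_weight tau p)) (n : nat) :
  weak_spectral_triple (fock_algebra F S n)
    (gscale (- 'i%C) (closure (fock_generator V F Hinf))).
Proof.
pose L := ampl_graph (K := K) V Hinf.
have Ls : is_subspace L by exact: ampl_subspace.
have Lfun x y : L (x, y) -> gapp L x = y by exact: ampl_gapp.
set D := fock_generator V F Hinf.
(* The vectors e_j (x) f with [f] in [Hinf] are total and start jets of [L], so their symmetric
   products give the analytic vectors of [D]. *)
have Dt : analytic_total D.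
  apply: (fock_analytic_total Lfun
      (B := [set z | exists j f, Hinf f /\ z = tens K (l2_basis l2 j) f])).
    apply/total_orthoP => y yB; apply: (ampl_total h1) => j f Hf.
    by apply: yB; exists j, f.
  move=> _ [j [f [Hf ->]]]; have [C [rho [C0 r0 hb]]] := ampl_analytic h1 K j Hf.
  by exists (fun k => ampl_jet V K k j f), C, rho; split=> //; exact: ampl_jetP.
have Ds : is_subspace D by exact: derivation_subspace.
have Gs : is_subspace (closure D) by exact: closure_graph_subspace.
have Gcl : closure (closure D) `<=` closure D by exact: closed_closure.
have Gsk : skew_graph (closure D).
  by apply: skew_closure; apply: derivation_skew; exact: ampl_skew.
have Gt : analytic_total (closure D) by apply: analytic_totalS Dt; exact: subset_closure.
apply: weak_spectral_triple_gen => // _ [f Sf <-].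
(* The generators are annihilation operators, that is, adjoints of creation operators, for which the
   commutator is explicit. *)
apply: derivable_adjoint => //.
have Hf : Hinf f by case: h2 => _ _ + _; exact.
(* A finite combination of vectors e_i (x) f with [f] in [Hinf] stays in the domain of [L]. *)
have [[u u'] Lu /= uE] : gdom L (fib_embed K n f).
  apply: (subspace_sum _ (gdom_subspace Ls)) => i _.
  apply: (subspaceZ _ (gdom_subspace Ls)).
  by exists (tens K (l2_basis l2 i) f, ampl_basis V K i f) => //; exact: ampl_mem.
rewrite -uE; apply: (closure_derivable (c := creation u')); try exact: creation_bounded.
by move=> x y; exact: creation_derivation.
Qed.
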